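(* Let $\mathcal{H}$ be a separable Hilbert space, $\mathcal{L}_0\subset\mathcal{H}$ a closed subspace, and let $Q$ be a bounded (not necessarily orthogonal) projection on $\mathcal{H}$ with range $R(Q)=\mathcal{L}_0$, written as $Q=\begin{pmatrix}1&A\\0&0\end{pmatrix}$ in terms of the decomposition $\mathcal{H}=\mathcal{L}_0\oplus\mathcal{L}_0^\perp$. Let $2Q-I=\rho_Q|2Q-I|$ be the polar decomposition of $2Q-I$. Then the following are equivalent: (1) $\rho_Q\in\mathbf{Sd}_{\mathcal{L}_0}$. (2) The operator $X$ of the Halmos model induced by the subspaces $R(Q)$ and $N(Q)$ is diagonalizable. (3) $QQ^*$ is diagonalizable (or, equivalently, $Q^*Q$ is diagonalizable). (4) $A$ is Schmidt decomposable.
   Context: A projection is a bounded operator $Q$ with $Q^2=Q$; $R(Q)$ and $N(Q)$ are its range and nullspace. In the polar decomposition $2Q-I=\rho_Q|2Q-I|$, $|T|=(T^*T)^{1/2}$, and $\rho_Q$ is a symmetry ($\rho_Q^*=\rho_Q=\rho_Q^{-1}$). An operator is diagonalizable if there is an orthonormal basis of the space consisting of its eigenvectors. A bounded operator $T$ (possibly between different Hilbert spaces) is Schmidt decomposable if there exist (finite or countable) orthonormal systems $\{f_n\}_{n\ge1}$ in the target, $\{g_n\}_{n\ge1}$ in the domain and positive numbers $s_n$ such that $T=\sum_{n\ge1}s_n\,f_n\otimes g_n$ (strong convergence), where $(f\otimes g)(h)=\langle h,g\rangle f$. $\mathbf{Sd}_{\mathcal{L}_0}$ is the set of unitaries $U$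 on $\mathcal{H}$ such that $P_0U|_{\mathcal{L}_0}:\mathcal{L}_0\to\mathcal{L}_0$ is Schmidt decomposable, where $P_0$ is the orthogonal projection onto $\mathcal{L}_0$. Halmos model induced by closed subspaces $\mathcal{S},\mathcal{T}$: the generic part is the orthogonal complement of $(\mathcal{S}\cap\mathcal{T})\oplus(\mathcal{S}^\perp\cap\mathcal{T}^\perp)\oplus(\mathcal{S}\cap\mathcal{T}^\perp)\oplus(\mathcal{S}^\perp\cap\mathcal{T})$. It is unitarily isomorphic to $\mathcal{K}\times\mathcal{K}$ for some Hilbert space $\mathcal{K}$ in such a way that the reductions of $P_{\mathcal{S}}$ and $P_{\mathcal{T}}$ to it become $\begin{pmatrix}1&0\\0&0\end{pmatrix}$ and $\begin{pmatrix}C^2&CS\\ CS&S^2\end{pmatrix}$, where $C=\cos(X)\ge0$, $S=\sin(X)\ge0$, $X$ selfadjoint on $\mathcal{K}$ with $0\le X\le\pi/2$, and $C,S,X$ have trivial nullspaces. Here $\mathcal{S}=R(Q)$ and $\mathcal{T}=N(Q)$. *)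

(* Defs.v *)
From HB Require Import structures.
From mathcomp Require Import all_boot all_order all_algebra.
From mathcomp Require Import complex.
From mathcomp Require Import all_classical all_reals all_analysis.

Set Implicit Arguments.
Unset Strict Implicit.
Unset Printing Implicit Defensive.

Import Order.TTheory GRing.Theory Num.Theory.
Import numFieldNormedType.Exports.

Local Open Scope classical_set_scope.
Local Open Scope ring_scope.
Local Open Scope complex_scope.

(* Complex Hilbert spaces: a Banach space over R[i] whose norm comes from a
   positive definite Hermitian form, linear in its first argument.  The norm
   of a normedModType R[i] takes (real, nonnegative) values in R[i]. *)
HB.mixin Record CompleteNormedModule_isHilbert (R : realType) H
    of CompleteNormedModule R[i] H := {
  inner : {dot H for @Num.conj R[i]};
  inner_norm : forall x : H, inner x x = `|x| ^+ 2
}.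

#[short(type="hilbertType")]
HB.structure Definition Hilbert (R : realType) :=
  {H of CompleteNormedModule_isHilbert R H & CompleteNormedModule R[i] H}.

Notation "''[' x , y ]" := (inner x y) (format "''[' x ,  y ]") : ring_scope.

Definition separable_space (T : topologicalType) : Prop :=
  exists2 D : set T, countable D & dense D.

Section Subspaces.
Context {R : realType} {H : hilbertType R}.

Definition closed_subspace (L : set H) : Prop :=
  [/\ L 0, forall (a : R[i]) x y, L x -> L y -> L (a *: x + y) & closed L].

Definition orthc (L : set H) : set H :=
  [set x | forall y, L y -> '[x, y] = 0].

(* The orthogonal projection onto L, meaningful when L is a closed subspace. *)
Definition oproj (L : set H) (x : H) : H :=
  xget 0 [set y | L y /\ orthc L (x - y)].

Definition orthonormal_set (E : set H) : Prop :=
  forall e e', E e -> E e' -> '[e, e'] = (e == e')%:R.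

Definition orthonormal_basis (E : set H) : Prop :=
  orthonormal_set E /\ smallest closed_subspace E = setT.

End Subspaces.

Definition nullspace {U V : zmodType} (T : U -> V) : set U := [set x | T x = 0].

Section Operators.
Context {R : realType}.

(* The adjoint, meaningful when T is linear and continuous. *)
Definition adjoint {H K : hilbertType R} (T : H -> K) : K -> H :=
  xget (fun=> 0) [set T' | forall x y, '[T x, y] = '[x, T' y]].

(* In the order of R[i], 0 <= z forces z to be real; hence this forces T to be
   selfadjoint. *)
Definition positive_op {H : hilbertType R} (T : H -> H) : Prop :=
  forall x, 0 <= '[T x, x].

Definition selfadjoint {H : hilbertType R} (T : H -> H) : Prop :=
  adjoint T = T.

Definition unitary_op {H : hilbertType R} (U : {linear H -> H}) : Prop :=
  (forall x y, '[U x, U y] = '[x, y]) /\ range U = setT.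

Definition partial_isometry {H : hilbertType R} (U : {linear H -> H}) : Prop :=
  continuous U /\ forall x, orthc (nullspace U) x -> `|U x| = `|x|.

(* B = |T|, the positive square root of T^* T *)
Definition is_abs {H : hilbertType R} (T : H -> H) (B : {linear H -> H}) : Prop :=
  [/\ continuous B, positive_op B & forall x, B (B x) = adjoint T (T x)].

(* T = U B with B = |T| *)
Definition polar_decomposition {H : hilbertType R} (T : H -> H)
    (U B : {linear H -> H}) : Prop :=
  [/\ is_abs T B, partial_isometry U, nullspace U = nullspace T
    & forall x, T x = U (B x)].

Definition eigenvector {H : hilbertType R} (T : H -> H) (e : H) : Prop :=
  e != 0 /\ exists a : R[i], T e = a *: e.

Definition diagonalizable_op {H : hilbertType R} (T : H -> H) : Prop :=
  exists2 E : set H, orthonormal_basis E & E `<=` eigenvector T.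

(* Schmidt decomposability of T restricted to the closed subspace D and seen as
   an operator from the Hilbert space D to the Hilbert space E.  The index set
   I of the orthonormal systems is an arbitrary set of natural numbers, so that
   finite (possibly empty) and countable systems are treated uniformly. *)
Definition schmidt_decomposable {H K : hilbertType R} (D : set H) (E : set K)
    (T : H -> K) : Prop :=
  exists (I : set nat) (f : nat -> K) (g : nat -> H) (s : nat -> R),
    [/\ forall n, I n -> [/\ E (f n), D (g n) & 0 < s n],
        forall m n, I m -> I n -> '[f m, f n] = (m == n)%:R,
        forall m n, I m -> I n -> '[g m, g n] = (m == n)%:R
      & forall h, D h ->
          (fun N => \sum_(0 <= n < N | n \in I) ((s n)%:C * '[h, g n]) *: f n)
            @ \oo --> T h].

(* The set of unitaries Sd_{L0} *)
Definition Sd {H : hilbertType R} (L0 : set H) : set {linear H -> H} :=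
  [set U | unitary_op U /\ schmidt_decomposable L0 L0 (oproj L0 \o U)].

(* Power series of the cosine and of the sine, which converge for every
   bounded operator X. *)
Definition cos_op {H : hilbertType R} (X : H -> H) (h : H) : H :=
  limn (series (fun k => ((-1) ^+ k / (k.*2)`!%:R : R[i]) *: iter k.*2 X h)).

Definition sin_op {H : hilbertType R} (X : H -> H) (h : H) : H :=
  limn (series (fun k =>
    ((-1) ^+ k / (k.*2.+1)`!%:R : R[i]) *: iter k.*2.+1 X h)).

(* The four subspaces are pairwise orthogonal. *)
Definition generic_part {H : hilbertType R} (S T : set H) : set H :=
  orthc [set x | exists a b c d,
    [/\ (S `&` T) a, (orthc S `&` orthc T) b,
        (S `&` orthc T) c & (orthc S `&` T) d]
    /\ x = a + b + c + d].

(* W is a unitary from the Hilbert space K x K onto the generic part of S and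
   T.  The inner product of K x K is the sum of those of the components, since
   the norm of the product normed module is the maximum norm. *)
Record halmos_model {H : hilbertType R} (S T : set H) (K : hilbertType R)
    (W : {linear (K * K)%type -> H}) (X : {linear K -> K}) : Prop := {
  halmos_isometry : forall u v, '[W u, W v] = '[u.1, v.1] + '[u.2, v.2] ;
  halmos_range : range W = generic_part S T ;
  halmos_X_continuous : continuous X ;
  halmos_X_selfadjoint : selfadjoint X ;
  halmos_X_ge0 : positive_op X ;
  halmos_X_le : forall h, '[X h, h] <= (pi / 2)%:C * '[h, h] ;
  halmos_X_null : nullspace X = [set 0] ;
  halmos_C_null : nullspace (cos_op X) = [set 0] ;
  halmos_S_null : nullspace (sin_op X) = [set 0] ;
  halmos_C_ge0 : positive_op (cos_op X) ;
  halmos_S_ge0 : positive_op (sin_op X) ;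
  halmos_projS : forall x y, oproj S (W (x, y)) = W (x, 0) ;
  halmos_projT : forall x y, oproj T (W (x, y)) =
    W (cos_op X (cos_op X x) + cos_op X (sin_op X y),
       cos_op X (sin_op X x) + sin_op X (sin_op X y))
}.

End Operators.

(* Main.v *)
Require Import Defs.
From HB Require Import structures.
From mathcomp Require Import all_boot all_order all_algebra.
From mathcomp Require Import complex.
From mathcomp Require Import all_classical all_reals all_analysis.
From mathcomp Require Import ring lra.

Set Implicit Arguments.
Unset Strict Implicit.
Unset Printing Implicit Defensive.

Import Order.TTheory GRing.Theory Num.Theory.
Import numFieldNormedType.Exports.

Local Open Scope classical_set_scope.
Local Open Scope ring_scope.

(** Write T = 2Q - 1, an involution with adjoint T', and let P be the orthogonal
projection onto L0.  Everything is compared with the selfadjoint operator QQ',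
which vanishes on the orthogonal complement of L0 and equals 1 + AA' on L0.

For a symmetric operator, diagonalizability only says that no nonzero vector is
orthogonal to all eigenvectors (diagonalizable_total); this reformulation needs
no choice of bases and passes through operators having the same eigenvectors.
If an operator is reduced by L0 and vanishes on its complement, only the
eigenvectors inside L0 matter (eig_total_reduce).  So each condition of the
theorem is shown equivalent to: the eigenvectors of QQ' in L0 are total in L0.

- QQ' and Q'Q: an eigenvector e of QQ' with nonzero eigenvalue gives the
  eigenvector Q'e of Q'Q, and the kernels take care of themselves
  (eig_total_swap).
- Schmidt decompositions: an operator Y is Schmidt decomposable exactly when the
  eigenvectors of YY' are total (schmidt_total); separability makes the
  orthonormal systems countable.  For Y = A extended by 0 one has
  YY' = QQ' - P, which has the eigenvectors of QQ' on L0.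
- The unitary factor rho of T: with the modulus B of T put M = B + B^-1.  Since
  T is an involution, M^2 = (T + T')^2 commutes with T and with P, hence so does
  M, because M is positive and bounded below (commute_sqr).  The compression
  S of rho to L0 then satisfies M S = S M = 2 on L0 while M^2 = 4 QQ' on L0,
  so SS' is the inverse of QQ' on L0 (polar_compression).
- The Halmos model: compressing the orthogonal projection onto N(Q) to L0 gives
  1 - (QQ')^-1 on L0, and on the generic part this is cos(X)^2.  Vectors of L0
  orthogonal to the generic part are eigenvectors of QQ'.  It remains to see
  that an eigenvector of cos(X)^2 is an eigenvector of X.  No functional
  calculus is used: cos(x) - cos(l) is x^2 - l^2 times a power series in x^2 and
  l^2, and an alternating-series estimate for 0 <= X <= pi/2 shows that the
  quotient is negative definite (cos_op_eigen_inv). *)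

Local Open Scope complex_scope.

(** * Complex scalars and real-valued norms *)

Lemma exists_invS_lt (R : realType) (e : R) : 0 < e ->
  exists N : nat, forall n, (N <= n)%N -> n.+1%:R^-1 < e.
Proof.
move=> e0; have := archi_boundP (ltW (_ : 0 < e^-1)); rewrite invr_gt0 => /(_ e0).
set N := Num.bound _ => hN; exists N => n Nn.
rewrite -[e]invrK ltf_pV2 ?posrE ?invr_gt0 //.
by apply: lt_le_trans hN _; rewrite ler_nat (leq_trans Nn).
Qed.

Section RealNorm.
Context {R : realType}.

(** Norms over R[i] take values in the partially ordered field R[i]; estimates
are carried out on this real-valued version. *)
Definition nrm {V : normedZmodType R[i]} (x : V) : R := complex.Re `|x|.

Lemma nrmE (V : normedZmodType R[i]) (x : V) : `|x| = (nrm x)%:C.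
Proof. by rewrite /nrm RRe_real ?normr_real. Qed.

Lemma nrm_ge0 (V : normedZmodType R[i]) (x : V) : 0 <= nrm x.
Proof. by rewrite -ler0c -nrmE. Qed.

Lemma nrm0 (V : normedZmodType R[i]) : nrm (0 : V) = 0.
Proof. by rewrite /nrm normr0. Qed.

Lemma nrm0_eq0 (V : normedZmodType R[i]) (x : V) : nrm x = 0 -> x = 0.
Proof. by move=> x0; apply: normr0_eq0; rewrite nrmE x0. Qed.

Lemma nrmN (V : normedZmodType R[i]) (x : V) : nrm (- x) = nrm x.
Proof. by rewrite /nrm normrN. Qed.

Lemma ler_nrmD (V : normedZmodType R[i]) (x y : V) :
  nrm (x + y) <= nrm x + nrm y.
Proof. by rewrite -lecR rmorphD /= -!nrmE ler_normD. Qed.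

Lemma nrmZ (V : normedModType R[i]) a (x : V) : nrm (a *: x) = nrm a * nrm x.
Proof. by apply: complexI; rewrite rmorphM /= -!nrmE normrZ. Qed.

Lemma nrmM (a b : R[i]) : nrm (a * b) = nrm a * nrm b.
Proof. by apply: complexI; rewrite rmorphM /= -!nrmE normrM. Qed.

Lemma nrm_real (a : R) : nrm a%:C = `|a|.
Proof. by apply: complexI; rewrite -nrmE normc_def /= expr0n addr0 sqrtr_sqr. Qed.

Lemma Re_le_nrm (a : R[i]) : complex.Re a <= nrm a.
Proof.
rewrite -lecR -nrmE; case: a => a b; rewrite normc_def lecR /=.
apply: le_trans (ler_norm _) _.
by rewrite -sqrtr_sqr ler_wsqrtr // lerDl sqr_ge0.
Qed.

Lemma conjcE (c : R[i]) : Num.conj c = (c^*)%C.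
Proof. by []. Qed.

Lemma conj_mul (c : R[i]) : Num.conj c * c = (nrm c ^+ 2)%:C.
Proof. by rewrite -normCKC nrmE rmorphXn. Qed.

Lemma conj_realC (r : R) : Num.conj r%:C = r%:C.
Proof. exact: conjc_real. Qed.

Lemma realcM (a b : R) : (a * b)%:C = a%:C * b%:C. Proof. exact: rmorphM. Qed.
Lemma realcB (a b : R) : (a - b)%:C = a%:C - b%:C. Proof. exact: rmorphB. Qed.
Lemma realcX (a : R) n : (a ^+ n)%:C = a%:C ^+ n. Proof. exact: rmorphXn. Qed.

Lemma conjM (a b : R[i]) : Num.conj (a * b) = Num.conj a * Num.conj b.
Proof. exact: rmorphM. Qed.

Lemma seq_cvgP (V : normedModType R[i]) (u : nat -> V) (l : V) :
  u @ \oo --> l <->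
  forall e : R, 0 < e -> exists N, forall n, (N <= n)%N -> nrm (l - u n) < e.
Proof.
split.
  move=> /cvgrPdist_lt h e e0; have := h e%:C; rewrite ltcR => /(_ e0).
  by case=> N _ hN; exists N => n /hN; rewrite /= nrmE ltcR.
move=> h; apply/cvgrPdist_lt => e e0.
have ee : e = (complex.Re e)%:C by rewrite RRe_real // gtr0_real.
have {}e0 : 0 < complex.Re e by rewrite -ltcR -ee.
case: (h _ e0) => N hN; exists N => // n /= /hN hn.
by rewrite nrmE ee ltcR.
Qed.

Lemma cauchy_seq_cvg (V : completeNormedModType R[i]) (u : nat -> V) :
  (forall e : R, 0 < e -> exists N, forall n, (N <= n)%N -> nrm (u N - u n) < e) ->
  exists l : V, u @ \oo --> l.
Proof.
move=> h; suff: cvg (u @ \oo) by move=> cu; exists (lim (u @ \oo)).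
apply: cauchy_cvg; apply: cauchy_exP => e e0.
have ee : e = (complex.Re e)%:C by rewrite RRe_real // gtr0_real.
have {}e0 : 0 < complex.Re e by rewrite -ltcR -ee.
case: (h _ e0) => N hN; exists (u N), N => // n /= /hN hn.
by rewrite -ball_normE /ball_ /= nrmE ee ltcR.
Qed.

Lemma closed_nrm (V : normedModType R[i]) (A : set V) :
  closed A <->
  forall x, (forall e : R, 0 < e -> exists2 y, A y & nrm (x - y) < e) -> A x.
Proof.
split.
  move=> cA x h; apply: cA => B /nbhs_ballP[e /= e0 xB].
  have ee : e = (complex.Re e)%:C by rewrite RRe_real // gtr0_real.
  have {}e0 : 0 < complex.Re e by rewrite -ltcR -ee.
  have [y Ay xy] := h _ e0; exists y; split => //; apply: xB.
  by rewrite -ball_normE /ball_ /= nrmE ee ltcR.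
move=> h x cx; apply: h => e e0.
have [|y [Ay]] := cx (ball x e%:C).
  by apply: nbhsx_ballx; rewrite ltcR.
by rewrite -ball_normE /ball_ /= nrmE ltcR => xy; exists y.
Qed.

Lemma continuous_bounded (V W : normedModType R[i]) (f : {linear V -> W}) :
  continuous f <-> exists2 b : R, 0 <= b & forall x, nrm (f x) <= b * nrm x.
Proof.
split.
  move=> /linear_bounded_continuous/linear_boundedP/pinfty_ex_gt0[r r0 h].
  have rr : r = (complex.Re r)%:C by rewrite RRe_real // gtr0_real.
  have {}r0 : 0 < complex.Re r by rewrite -ltcR -rr.
  exists (complex.Re r); first exact: ltW.
  by move=> x; have := h x; rewrite !nrmE [X in X * _]rr -rmorphM lecR.
move=> [b b0 h]; apply/linear_bounded_continuous/bounded_funP => r.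
exists (b%:C * r) => x xr; rewrite nrmE (le_trans (y := (b * nrm x)%:C)) ?lecR//.
by rewrite rmorphM /= -nrmE ler_wpM2l // ler0c.
Qed.

End RealNorm.

(** * Inner product calculus *)

Section Inner.
Context {R : realType} {H : hilbertType R}.
Implicit Types (x y z : H) (a : R[i]).

Lemma innerC x y : '[x, y] = Num.conj '[y, x].
Proof. by rewrite hermC expr0 mul1r. Qed.
Lemma innerDl x y z : '[x + y, z] = '[x, z] + '[y, z].
Proof. exact: linearDl. Qed.
Lemma innerZl a x z : '[a *: x, z] = a * '[x, z].
Proof. exact: linearZl_LR. Qed.
Lemma innerDr z x y : '[z, x + y] = '[z, x] + '[z, y].
Proof. exact: linearDr. Qed.
Lemma innerZr z a x : '[z, a *: x] = Num.conj a * '[z, x].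
Proof. exact: linearZr_LR. Qed.
Lemma inner0l x : '[0, x] = 0. Proof. exact: linear0l. Qed.
Lemma inner0r x : '[x, 0] = 0. Proof. exact: linear0r. Qed.
Lemma innerNl x y : '[- x, y] = - '[x, y]. Proof. exact: linearNl. Qed.
Lemma innerNr x y : '[x, - y] = - '[x, y]. Proof. exact: linearNr. Qed.
Lemma innerBl x y z : '[x - y, z] = '[x, z] - '[y, z].
Proof. exact: linearBl. Qed.
Lemma innerBr z x y : '[z, x - y] = '[z, x] - '[z, y].
Proof. exact: linearBr. Qed.
Lemma inner_suml I (r : seq I) (P : pred I) (F : I -> H) z :
  '[\sum_(i <- r | P i) F i, z] = \sum_(i <- r | P i) '[F i, z].
Proof. exact: linear_sumlz. Qed.

Definition innerE := (innerDl, innerDr, innerBl, innerBr, innerNl, innerNr,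
  innerZl, innerZr, inner0l, inner0r).

Lemma inner_nrm x : '[x, x] = (nrm x ^+ 2)%:C.
Proof. by rewrite inner_norm nrmE rmorphXn. Qed.

Lemma inner_eq0 x : '[x, x] = 0 -> x = 0.
Proof.
by rewrite inner_nrm => /(congr1 (@complex.Re R))/= /eqP; rewrite sqrf_eq0
  => /eqP/nrm0_eq0.
Qed.

(** Identities between vectors are proved by testing against all vectors, which
turns them into identities between scalars. *)
Lemma inner_inj x y : (forall z, '[x, z] = '[y, z]) -> x = y.
Proof.
by move=> h; apply/subr0_eq/inner_eq0; rewrite innerBl h subrr.
Qed.

Lemma inner_injr x y : (forall z, '[z, x] = '[z, y]) -> x = y.
Proof. by move=> h; apply: inner_inj => z; rewrite innerC h -innerC. Qed.

Lemma inner0C x y : '[x, y] = 0 -> '[y, x] = 0.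
Proof. by move=> h; rewrite innerC h rmorph0. Qed.

Lemma Re_innerC x y : complex.Re '[x, y] = complex.Re '[y, x].
Proof. by rewrite innerC; case: '[y, x]. Qed.

Lemma sqr_nrm x : nrm x ^+ 2 = complex.Re '[x, x].
Proof. by rewrite inner_nrm. Qed.

Lemma sqr_nrmD x y :
  nrm (x + y) ^+ 2 = nrm x ^+ 2 + nrm y ^+ 2 + 2 * complex.Re '[x, y].
Proof.
rewrite !sqr_nrm !innerE /= !raddfD /= (Re_innerC y x); ring.
Qed.

Lemma sqr_nrmB x y :
  nrm (x - y) ^+ 2 = nrm x ^+ 2 + nrm y ^+ 2 - 2 * complex.Re '[x, y].
Proof. by rewrite sqr_nrmD nrmN innerNr raddfN mulrN. Qed.

Lemma parallelogram x y :
  nrm (x + y) ^+ 2 + nrm (x - y) ^+ 2 = 2 * (nrm x ^+ 2 + nrm y ^+ 2).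
Proof. rewrite sqr_nrmD sqr_nrmB; ring. Qed.

Lemma pythagoras x y : '[x, y] = 0 ->
  nrm (x + y) ^+ 2 = nrm x ^+ 2 + nrm y ^+ 2.
Proof. by rewrite sqr_nrmD => ->; rewrite /= mulr0 addr0. Qed.

End Inner.

(** * Positive operators and the Cauchy-Schwarz inequality *)

Section Positive.
Context {R : realType} {H : hilbertType R}.
Implicit Types (x y z : H) (a : R[i]).

(** Polarization: the imaginary part of the quadratic form vanishes at x + y and
at x + i y. *)
Lemma positive_symmetric (T : {linear H -> H}) : positive_op T ->
  forall x y, '[T x, y] = '[x, T y].
Proof.
move=> pT x y; rewrite [RHS]innerC.
have h u v : complex.Im ('[T u, v] + '[T v, u]) = 0.
  have /ger0_Im := pT (u + v); rewrite (linearD T) !innerE !raddfD /=.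
  rewrite !(ger0_Im (pT _)); lra.
have := h x y; have := h x (('i)%C *: y); rewrite innerZr (linearZZ T) /= innerZl conjcE.
case: '[T x, y] => p q; case: '[T y, x] => r s /= h1 h2; rewrite conjcE /=.
by congr Complex; lra.
Qed.

(** The form of T at x - l z y is nonnegative for every real l, where z is the
value of the form at (x, y); this is a quadratic inequality in l. *)
Lemma positive_Cauchy_Schwarz (T : {linear H -> H}) x y : positive_op T ->
  nrm '[T x, y] ^+ 2 <= complex.Re '[T x, x] * complex.Re '[T y, y].
Proof.
move=> pT; set z := '[T x, y]; set p := complex.Re _; set r := complex.Re _.
have re u : '[T u, u] = (complex.Re '[T u, u])%:C.
  by rewrite RRe_real // ger0_real.
have p0 : 0 <= p by rewrite -ler0c /p -re.
have r0 : 0 <= r by rewrite -ler0c /r -re.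
have zyx : '[T y, x] = Num.conj z by rewrite positive_symmetric // innerC.
have key (l : R) : 0 <= p - 2 * l * nrm z ^+ 2 + l ^+ 2 * nrm z ^+ 2 * r.
  have := pT (x - (l%:C * z) *: y).
  rewrite (linearB T) (linearZZ T) !innerE zyx (re x) (re y).
  rewrite conjM conj_realC -/z -/p -/r.
  set e := (X in 0 <= X -> _).
  have -> : e = p%:C - 2 * l%:C * (Num.conj z * z)
                + l%:C ^+ 2 * (Num.conj z * z) * r%:C.
    by rewrite /e; ring.
  rewrite conj_mul -[2]/(2%:R) -(rmorph_nat (real_complex R)) -!rmorphXn -!rmorphM.
  by rewrite -rmorphB -rmorphD ler0c.
set m := nrm z ^+ 2 in key *; have m0 : 0 <= m by rewrite sqr_ge0.
have [rp|] := ltP 0 r.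
  (* l = 1 / r minimizes the quadratic when r > 0. *)
  have := key r^-1; rewrite -(ler_pM2r rp) mul0r => h.
  have e1 : (p - 2 / r * m + r^-1 ^+ 2 * m * r) * r = p * r - m.
    by field; rewrite gt_eqF.
  by move: h; rewrite e1; lra.
move=> r1; have {r0 r1} r0 : r = 0 by lra.
rewrite r0 mulr0; have [//|mp] := leP m 0.
(* For r = 0 the quadratic is affine in l, and negative for this l. *)
have := key ((p + 1) / m); rewrite r0.
have -> : p - 2 * ((p + 1) / m) * m + ((p + 1) / m) ^+ 2 * m * 0 = - p - 2.
  by field; rewrite gt_eqF.
by lra.
Qed.

Lemma Cauchy_Schwarz x y : nrm '[x, y] <= nrm x * nrm y.
Proof.
rewrite -ler_sqr ?nnegrE ?mulr_ge0 ?nrm_ge0 // exprMn !sqr_nrm.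
apply: (@positive_Cauchy_Schwarz idfun).
by move=> u /=; rewrite inner_nrm ler0c sqr_ge0.
Qed.

(** The operator inequality T^2 <= b T for 0 <= T <= b, by the Cauchy-Schwarz
inequality for the form of T at x and T x. *)
Lemma positive_sqr_bound (T : {linear H -> H}) (b : R) : 0 <= b ->
  positive_op T -> (forall x, complex.Re '[T x, x] <= b * nrm x ^+ 2) ->
  forall x, nrm (T x) ^+ 2 <= b * complex.Re '[T x, x].
Proof.
move=> b0 pT Tb x; have := positive_Cauchy_Schwarz x (T x) pT.
rewrite inner_nrm nrm_real ger0_norm ?sqr_ge0 // => h.
have p0 : 0 <= complex.Re '[T x, x] by rewrite -ler0c RRe_real ?pT ?ger0_real ?pT.
have := Tb (T x); move: h; set t := nrm (T x) ^+ 2; set r := complex.Re '[T (T x), _].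
set p := complex.Re _ in p0 * => h1 h2.
have t0 : 0 <= t by rewrite sqr_ge0.
have [->|tn] := eqVneq t 0; first by rewrite mulr_ge0.
have tp : 0 < t by rewrite lt_def tn.
by rewrite -(ler_pM2r tp); have := ler_wpM2l p0 h2; lra.
Qed.

End Positive.

(** * Orthogonal projections and the Riesz representation *)

Section Projection.
Context {R : realType} {H : hilbertType R}.
Implicit Types (x y z : H) (a : R[i]) (M : set H).

Lemma subspaceD M x y : closed_subspace M -> M x -> M y -> M (x + y).
Proof. by case=> _ h _ Mx My; rewrite -[x]scale1r; apply: h. Qed.
Lemma subspaceZ M a x : closed_subspace M -> M x -> M (a *: x).
Proof. by case=> h0 h _ Mx; rewrite -[a *: x]addr0; apply: h. Qed.
Lemma subspaceB M x y : closed_subspace M -> M x -> M y -> M (x - y).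
Proof.
by move=> cM Mx My; apply: subspaceD => //; rewrite -scaleN1r; apply: subspaceZ.
Qed.

(** A minimizing sequence for the distance from x to M is Cauchy by the
parallelogram law, and its limit is the foot of the perpendicular. *)
Lemma subspace_proj M x : closed_subspace M ->
  exists2 y, M y & orthc M (x - y).
Proof.
move=> cM; have [M0 ML Mc] := cM.
pose D := [set nrm (x - y) | y in M].
have D0 : D !=set0 by exists (nrm (x - 0)), 0.
have lbD : lbound D 0 by move=> _ [y _ <-]; exact: nrm_ge0.
have hD : has_inf D by split => //; exists 0.
pose d := inf D.
have d0 : 0 <= d by apply: lb_le_inf.
have dle y : M y -> d <= nrm (x - y).
  by move=> My; apply: ge_inf; [exists 0|exists y].
have /choice[u hu] : forall n : nat, exists y, M y /\ nrm (x - y) < d + n.+1%:R^-1.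
  move=> n; have : 0 < n.+1%:R^-1 :> R by rewrite invr_gt0.
  by move=> e0; have [_ [y My <-] lt] := inf_adherent e0 hD; exists y.
have uM n : M (u n) by case: (hu n).
have ud n : nrm (x - u n) < d + n.+1%:R^-1 by case: (hu n).
have cau e : 0 < e -> exists N, forall n, (N <= n)%N -> nrm (u N - u n) < e.
  move=> e0; have d4 : 0 < 8 * d + 4 by lra.
  have [|N /(_ _ (leqnn N)) Ne] := exists_invS_lt (e := e ^+ 2 / (8 * d + 4)).
    by rewrite divr_gt0 ?exprn_gt0.
  rewrite ltr_pdivlMr // mulrC in Ne.
  exists N => n Nn; rewrite -ltr_sqr ?nnegrE ?nrm_ge0 ?ltW //.
  apply: le_lt_trans Ne; set i := N.+1%:R^-1.
  have i0 : 0 <= i by rewrite invr_ge0.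
  have i1 : i <= 1 by rewrite invf_le1 // ler1n.
  have uNd := ud N; have und : nrm (x - u n) < d + i.
    apply: lt_le_trans (ud n) _; rewrite lerD2l lef_pV2 ?posrE // ler_nat ltnS //.
  have := parallelogram (x - u N) (x - u n).
  have -> : x - u N - (x - u n) = - (u N - u n).
    by rewrite opprB addrC addrA subrK opprB.
  rewrite nrmN.
  have -> : x - u N + (x - u n) = (2 : R[i]) *: (x - (1 / 2) *: (u N + u n)).
    rewrite scalerBr scalerA mulrC divfK ?pnatr_eq0 // scale1r.
    by rewrite opprD addrACA scaler_nat mulr2n.
  rewrite nrmZ; have -> : nrm (2 : R[i]) = 2 :> R.
    by apply: complexI; rewrite -nrmE normr_nat rmorph_nat.
  have := dle _ (subspaceZ (1 / 2) cM (subspaceD cM (uM N) (uM n))).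
  move: (nrm (x - _ *: _)) (nrm_ge0 (x - u N)) (nrm_ge0 (x - u n)) uNd und.
  move: (nrm (x - u N)) (nrm (x - u n)) (nrm (u N - u n)) => p q r s.
  rewrite -/i => p0 q0 pd qd sd pr.
  have p2 : p ^+ 2 <= (d + i) ^+ 2 by rewrite ler_sqr ?nnegrE ?addr_ge0 // ltW.
  have q2 : q ^+ 2 <= (d + i) ^+ 2 by rewrite ler_sqr ?nnegrE ?addr_ge0 // ltW.
  have s2 : d ^+ 2 <= s ^+ 2 by rewrite ler_sqr ?nnegrE // (le_trans d0).
  have -> : r ^+ 2 = 2 * (p ^+ 2 + q ^+ 2) - 4 * s ^+ 2.
    by rewrite -pr; ring.
  have : i ^+ 2 <= i by rewrite expr2 ler_piMl.
  move: p2 q2; rewrite sqrrD; nra.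
have [y /seq_cvgP uy] := cauchy_seq_cvg cau.
have My : M y.
  move/closed_nrm: Mc; apply => e /uy[N hN].
  by exists (u N) => //; apply: hN.
exists y => // z Mz; set w := x - y.
have wd : nrm w <= d.
  apply/ler_addgt0Pr => e e0; have e20 : 0 < e / 2 by rewrite divr_gt0.
  have [N hN] := uy _ e20; have [N' hN'] := exists_invS_lt e20.
  pose n := maxn N N'.
  have {hN}hN := hN n (leq_maxl _ _); have {hN'}hN' := hN' n (leq_maxr _ _).
  have -> : w = (x - u n) + - (y - u n) by rewrite opprB addrA subrK.
  apply: le_trans (ler_nrmD _ _) _; rewrite nrmN.
  have := ud n; move: hN hN'; move: (nrm (x - u n)) (nrm (y - u n)) n.+1%:R^-1.
  by move=> *; lra.
(* Moving from the closest point in the direction of l c z decreases the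
   distance unless c = 0. *)
pose c := '[w, z]; pose l := (nrm z ^+ 2 + 1)^-1.
have l0 : 0 < l by rewrite invr_gt0 ltr_wpDl ?sqr_ge0.
have : d <= nrm (w - (l%:C * c) *: z).
  rewrite /w -addrA -opprD; apply: dle.
  by apply: subspaceD => //; apply: subspaceZ.
rewrite -ler_sqr ?nnegrE ?nrm_ge0 //.
rewrite sqr_nrmB nrmZ nrmM nrm_real innerZr -/c.
have -> : complex.Re (Num.conj (l%:C * c) * c) = l * nrm c ^+ 2.
  by rewrite conjM conj_realC -mulrA conj_mul -rmorphM.
rewrite ger0_norm ?(ltW l0) // !exprMn => h.
have w2 : nrm w ^+ 2 <= d ^+ 2 by rewrite ler_sqr ?nnegrE ?nrm_ge0.
have l1 : l * (nrm z ^+ 2 + 1) = 1.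
  by rewrite /l mulVf // gt_eqF // ltr_wpDl ?sqr_ge0.
have h2 : 0 <= nrm c ^+ 2 * (l * (l * (nrm z ^+ 2) - 2)).
  have : 0 <= l ^+ 2 * nrm c ^+ 2 * nrm z ^+ 2 - 2 * (l * nrm c ^+ 2) by lra.
  by congr (_ <= _); ring.
have h3 : l * (l * (nrm z ^+ 2) - 2) < 0.
  rewrite pmulr_rlt0 //.
  have -> : l * nrm z ^+ 2 = 1 - l by rewrite -l1; ring.
  lra.
have : nrm c ^+ 2 = 0.
  by apply/eqP; rewrite eq_le sqr_ge0 andbT; rewrite nmulr_lge0 // in h2.
by move=> /eqP; rewrite sqrf_eq0 => /eqP/nrm0_eq0.
Qed.

Lemma orthc_self M x : M x -> orthc M x -> x = 0.
Proof. by move=> Mx /(_ _ Mx)/inner_eq0. Qed.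

Lemma orthcB M x y : orthc M x -> orthc M y -> orthc M (x - y).
Proof. by move=> hx hy z Mz; rewrite innerBl hx // hy // subrr. Qed.

Lemma orthcD M x y : orthc M x -> orthc M y -> orthc M (x + y).
Proof. by move=> hx hy z Mz; rewrite innerDl hx // hy // addr0. Qed.

Lemma orthcZ M a x : orthc M x -> orthc M (a *: x).
Proof. by move=> hx z Mz; rewrite innerZl hx // mulr0. Qed.

Lemma orthc_closed_subspace M : closed_subspace (orthc M).
Proof.
split; first by move=> y _; rewrite inner0l.
  by move=> a x y hx hy; apply: orthcD => //; apply: orthcZ.
apply/closed_nrm => x hx z Mz; apply: nrm0_eq0; apply/eqP.
rewrite eq_le nrm_ge0 andbT; apply/ler_addgt0Pr => e e0; rewrite add0r.
have z1 : 0 < nrm z + 1 by rewrite ltr_wpDl ?nrm_ge0.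
have [|y hy xy] := hx (e / (nrm z + 1)); first by rewrite divr_gt0.
have -> : '[x, z] = '[x - y, z] by rewrite innerBl hy // subr0.
apply: le_trans (Cauchy_Schwarz _ _) _.
apply: le_trans (ler_wpM2r (nrm_ge0 _) (ltW xy)) _.
rewrite -mulrA ler_piMr ?ltW // mulrC ltr_pdivrMr //.
by rewrite mul1r ltrDl.
Qed.

Lemma oprojP M x : closed_subspace M -> M (oproj M x) /\ orthc M (x - oproj M x).
Proof.
by move=> /(subspace_proj x)[y My hy]; rewrite /oproj; case: xgetP => [z _ []//|/(_ y) []].
Qed.

Lemma oproj_uniq M x y : closed_subspace M -> M y -> orthc M (x - y) ->
  oproj M x = y.
Proof.
move=> cM My xy; have [h1 h2] := oprojP x cM.
apply/subr0_eq/(@orthc_self M); first exact: subspaceB.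
have -> : oproj M x - y = (x - y) - (x - oproj M x) by rewrite opprB [RHS]addrC addrA subrK.
exact: orthcB.
Qed.

Lemma oproj_sym M x y : closed_subspace M -> '[oproj M x, y] = '[x, oproj M y].
Proof.
move=> cM; have [Mx xM] := oprojP x cM; have [My yM] := oprojP y cM.
rewrite -[in LHS](subrKC (oproj M y) y) innerDr (inner0C (yM _ Mx)) addr0.
by rewrite -[in RHS](subrKC (oproj M x) x) innerDl (xM _ My) addr0.
Qed.

Lemma orthcK M : closed_subspace M -> orthc (orthc M) = M.
Proof.
move=> cM; apply/seteqP; split => x.
  have [h1 h2] := oprojP x cM => hx.
  have : x - oproj M x = 0.
    apply: inner_eq0; rewrite innerBl hx // sub0r innerC h2 //.
    by rewrite rmorph0 oppr0.
  by move=> /subr0_eq ->.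
by move=> Mx y /(_ _ Mx); apply: inner0C.
Qed.

(** A vector orthogonal to the kernel of the functional represents it up to a
scalar. *)
Lemma Riesz (phi : H -> R[i]) (b : R) :
  (forall a x y, phi (a *: x + y) = a * phi x + phi y) ->
  (forall x, nrm (phi x) <= b * nrm x) ->
  exists z, forall x, phi x = '[x, z].
Proof.
move=> lphi bphi.
have phi0 : phi 0 = 0.
  by have := lphi (-1) 0 0; rewrite scaler0 addr0 mulN1r addNr.
have phiZ a x : phi (a *: x) = a * phi x.
  by have := lphi a x 0; rewrite !addr0 phi0 addr0.
have phiD x y : phi (x + y) = phi x + phi y.
  by have := lphi 1 x y; rewrite scale1r mul1r.
have phiB x y : phi (x - y) = phi x - phi y.
  by rewrite phiD -scaleN1r phiZ mulN1r.
have [h|] := pselect (forall x, phi x = 0).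
  by exists 0 => x; rewrite h inner0r.
move=> /existsNP[x0 /eqP x0n]; pose N := [set x | phi x = 0].
have cN : closed_subspace N.
  split => //; first by move=> a x y Nx Ny; rewrite /N /= lphi Nx Ny mulr0 addr0.
  apply/closed_nrm => x hx; apply: nrm0_eq0; apply/eqP.
  rewrite eq_le nrm_ge0 andbT; apply/ler_addgt0Pr => e e0; rewrite add0r.
  have b0 : 0 < `|b| + 1 by rewrite ltr_wpDl.
  have [|y hy xy] := hx (e / (`|b| + 1)); first by rewrite divr_gt0.
  have -> : phi x = phi (x - y) by rewrite phiB hy subr0.
  apply: le_trans (bphi _) _; apply: le_trans (ler_wpM2r (nrm_ge0 _) (ler_norm b)) _.
  apply: le_trans (ler_wpM2l (normr_ge0 _) (ltW xy)) _.
  by rewrite mulrA ler_pdivrMr // mulrC ler_pM2l // lerDl.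
have [p Np pN] := subspace_proj x0 cN; pose w := x0 - p.
have pw : phi w != 0 by rewrite /w phiB Np subr0.
have w0 : '[w, w] != 0.
  by apply: contra pw => /eqP/inner_eq0 ->; rewrite phi0.
exists (Num.conj (phi w / '[w, w]) *: w) => x.
have : '[x - (phi x / phi w) *: w, w] = 0.
  by apply: inner0C; apply: pN; rewrite /N /= phiB phiZ divfK // subrr.
rewrite innerBl innerZl innerZr conjCK => /subr0_eq ->.
by field; rewrite pw w0.
Qed.

End Projection.

(** * Adjoint pairs *)

Section Adjoint.
Context {R : realType} {H K : hilbertType R}.

Lemma adjoint_uniq (T : H -> K) (T' : K -> H) :
  (forall x y, '[T x, y] = '[x, T' y]) -> adjoint T = T'.
Proof.
move=> h; rewrite /adjoint; case: xgetP => [S _ hS|/(_ T')]; last by case.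
by apply: funext => y; apply: inner_injr => x; rewrite -hS h.
Qed.

Lemma adjointP (T : {linear H -> K}) : continuous T ->
  forall x y, '[T x, y] = '[x, adjoint T y].
Proof.
move=> /continuous_bounded[b b0 Tb].
have /choice[T' hT'] : forall y, exists z, forall x, '[T x, y] = '[x, z].
  move=> y; apply: (@Riesz _ _ _ (b * nrm y)).
    by move=> a u v; rewrite linearP innerDl innerZl.
  move=> x; apply: le_trans (Cauchy_Schwarz _ _) _.
  by rewrite mulrAC ler_wpM2r ?nrm_ge0.
have h x y : '[T x, y] = '[x, T' y] by [].
by rewrite (adjoint_uniq h).
Qed.

End Adjoint.

Section AdjointPairs.
Context {R : realType} {H K : hilbertType R}.

Lemma adj_sym (T : H -> K) (T' : K -> H) :
  (forall x y, '[T x, y] = '[x, T' y]) -> forall x y, '[T' x, y] = '[x, T y].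
Proof. by move=> h x y; rewrite innerC -h -innerC. Qed.

(** An operator that has an adjoint is automatically linear, so linearity need
not be proved separately for the compositions considered below. *)
Lemma adj_linear (T : H -> K) (T' : K -> H) :
  (forall x y, '[T x, y] = '[x, T' y]) -> linear T.
Proof.
by move=> h a x y; apply: inner_inj => z; rewrite !(h, innerE).
Qed.

Lemma linearizable (T : H -> K) : linear T ->
  exists L : {linear H -> K}, T = L.
Proof.
move=> lT; have li := GRing.isLinear.Build _ _ _ _ _ lT.
by exists (HB.pack_for {linear H -> K} T li).
Qed.

End AdjointPairs.

Lemma oproj_linear (R : realType) (H : hilbertType R) (M : set H) :
  closed_subspace M -> exists P : {linear H -> H}, oproj M = P.
Proof.
move=> cM; apply: linearizable; apply: (@adj_linear _ _ _ _ (oproj M)) => x y.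
exact: oproj_sym.
Qed.

(** * Closed spans and diagonalization by total eigenvectors *)

Section Span.
Context {R : realType} {H : hilbertType R}.
Implicit Types (x y z e : H) (a : R[i]) (E M : set H).

Definition cspan E : set H := smallest closed_subspace E.

Lemma sub_cspan E : E `<=` cspan E.
Proof. by move=> x Ex M [_ /(_ _ Ex)]. Qed.

Lemma cspan_min E M : closed_subspace M -> E `<=` M -> cspan E `<=` M.
Proof. by move=> cM EM x; apply. Qed.

Lemma cspan_closed E : closed_subspace (cspan E).
Proof.
split.
- by move=> M [[]].
- by move=> a x y hx hy M hM; case: (hM) => -[_ h _] _; apply: h; [exact: hx|exact: hy].
- apply/closed_nrm => x hx M hM; case: (hM) => -[_ _ /closed_nrm h] _; apply: h.
  by move=> e /hx[y hy xy]; exists y => //; exact: hy.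
Qed.

(** The vectors orthogonal to a given x form a closed subspace, so being
orthogonal to E propagates to the closed span. *)
Lemma orthc_cspan E : orthc (cspan E) = orthc E.
Proof.
apply/seteqP; split => x hx y hy; first by apply: hx; exact: sub_cspan.
apply: inner0C.
have : orthc [set x] y.
  apply: (cspan_min _ _ hy); first exact: orthc_closed_subspace.
  by move=> z Ez _ ->; apply/inner0C/hx.
exact.
Qed.

End Span.

Section Diagonalization.
Context {R : realType} {H : hilbertType R}.
Implicit Types (x y z e v : H) (E M : set H).

Definition eig_total (T : H -> H) : Prop :=
  forall v, (forall e, eigenvector T e -> '[v, e] = 0) -> v = 0.

(** For the converse direction take a maximal orthonormal set E of eigenvectors.
Its orthogonal complement is invariant under T, so the component orthogonal to E
of an eigenvector e is zero or again an eigenvector for the same eigenvalue; by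
maximality it is zero.  Thus a vector orthogonal to E is orthogonal to all
eigenvectors. *)
Lemma diagonalizable_total (T : H -> H) :
  (forall x y, '[T x, y] = '[x, T y]) ->
  (diagonalizable_op T <-> eig_total T).
Proof.
move=> sT; split.
  move=> [E [oE bE] eE] v hv; apply: inner_eq0.
  have : orthc (cspan E) v by rewrite orthc_cspan => e /eE; exact: hv.
  by apply; rewrite /cspan bE.
move=> tT; have lT := adj_linear sT.
have [L TL] := linearizable lT.
pose P E := orthonormal_set E /\ E `<=` eigenvector T.
have [|E [[oE eE] maxE]] := @Zorn_bigcup _ P.
  move=> F FP tF; split; last by move=> e [A /FP[_ h] /h].
  move=> e e' [A FA Ae] [B FB Be'].
  have [AB|BA] := tF _ _ FA FB.
    by have [oB _] := FP _ FB; apply: oB => //; apply: AB.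
  by have [oA _] := FP _ FA; apply: oA => //; apply: BA.
exists E => //; split => //; rewrite -/(cspan E).
have cE := cspan_closed E.
have TE x : orthc (cspan E) x -> orthc (cspan E) (T x).
  rewrite orthc_cspan => hx e Ee; have [_ [a ea]] := eE _ Ee.
  by rewrite sT ea innerZr hx // mulr0.
suff orthE v : orthc (cspan E) v -> v = 0.
  rewrite -(orthcK cE); apply/seteqP; split => // x _ y /orthE ->.
  by rewrite inner0r.
move=> hv; apply: tT => e [en0 [a ea]].
have [m_in n_orth] := oprojP e cE; set m := oproj _ e in m_in n_orth.
set n := e - m in n_orth.
suff n0 : n = 0 by rewrite (hv _ _) // (subr0_eq n0).
have Tm : cspan E (T m).
  rewrite -(orthcK cE) => w hw; rewrite sT; apply: inner0C.
  by apply: TE.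
(* T n - a n lies both in the closed span of E and in its complement. *)
have Tn : T n = a *: n.
  apply/subr0_eq/(@orthc_self _ _ (cspan E)); last first.
    by apply: orthcB; [exact: TE|exact: orthcZ].
  have -> : T n - a *: n = a *: m - T m.
    rewrite /n TL (linearB L) -TL ea scalerBr; set u := a *: e.
    by rewrite opprB addrC addrA subrK.
  by apply: (subspaceB cE _ Tm); apply: (subspaceZ _ cE).
apply/eqP/negP => /negP n0.
have nn0 : nrm n != 0 by apply: contra n0 => /eqP/nrm0_eq0 ->.
pose u := (nrm n)^-1%:C *: n.
have uu : '[u, u] = 1.
  rewrite /u innerZl innerZr conj_realC inner_nrm -!realcM.
  by rewrite mulrA -expr2 -exprMn mulVf // expr1n.
have uE e' : E e' -> '[u, e'] = 0.
  by move=> Ee'; rewrite innerZl n_orth ?mulr0 //; exact: sub_cspan.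
have uNE : ~ E u.
  by move=> /uE; rewrite uu => /eqP; rewrite oner_eq0.
apply: (maxE (E `|` [set u])).
  split; first by move=> x; left.
  by move=> /(_ u) h; apply/uNE/h; right.
have uneq e' : E e' -> (u == e') = false.
  by move=> Ee'; apply/negP => /eqP ue; apply: uNE; rewrite ue.
split.
  move=> x y [Ex|->] [Ey|->].
  - exact: oE.
  - by rewrite eq_sym uneq // innerC uE // rmorph0.
  - by rewrite uneq // uE.
  - by rewrite eqxx uu.
move=> x [/eE //|->]; split.
  by apply/eqP => u0; move: uu; rewrite u0 inner0l => /eqP; rewrite eq_sym oner_eq0.
exists a; rewrite TL (linearZZ L) -TL Tn /u !scalerA; congr (_ *: _).
by rewrite mulrC.
Qed.

Lemma eigenvector0P (T : H -> H) e a : T e = a *: e -> e = 0 \/ eigenvector T e.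
Proof.
move=> h; have [->|e0] := eqVneq e 0; first by left.
by right; split => //; exists a.
Qed.

(** Distinct orthonormal vectors are at distance sqrt 2, so balls of radius 1/2
around them contain different points of a countable dense set. *)
Lemma orthonormal_countable E :
  separable_space H -> orthonormal_set E -> countable E.
Proof.
move=> [D /countable_injP[j jinj] dD] oE.
have /choice[d hd] : forall e, exists x, D x /\ nrm (e - x) < 1 / 2.
  move=> e; have [||x [ex Dx]] := dD (ball e (1 / 2)%:C)°.
  - exists e; apply: nbhsx_ballx; rewrite ltcR; lra.
  - exact: open_interior.
  exists x; split => //; move/interior_subset: ex.
  by rewrite -ball_normE /ball_ /= nrmE ltcR.
apply/countable_injP; exists (j \o d) => e e' /set_mem Ee /set_mem Ee' /= h.
have {h}de : d e = d e' by apply: jinj => //; apply: mem_set; case: (hd e); case: (hd e').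
apply/eqP/negP => /negP ne.
have : nrm (e - e') ^+ 2 = 2.
  rewrite sqr_nrmB !sqr_nrm !oE // !eqxx (negbTE ne) /=; lra.
have : nrm (e - e') < 1.
  have -> : e - e' = (e - d e) - (e' - d e') by rewrite de opprB addrA subrK.
  apply: le_lt_trans (ler_nrmD _ _) _; rewrite nrmN.
  have [_ h1] := hd e; have [_ h2] := hd e'; lra.
have := nrm_ge0 (e - e'); nra.
Qed.

End Diagonalization.

(** * Fourier and Schmidt expansions *)

Lemma big_nat_single (V : nmodType) (F : nat -> V) (I : set nat) m N :
  I m -> (m < N)%N -> (forall n, I n -> n != m -> F n = 0) ->
  \sum_(0 <= n < N | n \in I) F n = F m.
Proof.
move=> Im mN F0; rewrite big_mkcond (bigD1_seq m) /= ?iota_uniq ?mem_index_iota //.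
rewrite mem_set // big1 ?addr0 // => i im.
by case: ifP => // /set_mem Ii; exact: F0.
Qed.

Section Fourier.
Context {R : realType} {H : hilbertType R}.
Implicit Types (x y z e v u : H).

(** Continuity of the inner product, in the only form used: the inner products of
the partial sums are eventually constant. *)
Lemma inner_lim (u : nat -> H) l y (c : R[i]) :
  u @ \oo --> l -> (exists N0, forall n, (N0 <= n)%N -> '[u n, y] = c) ->
  '[l, y] = c.
Proof.
move=> /seq_cvgP ul [N0 uc]; apply/subr0_eq/nrm0_eq0/eqP.
rewrite eq_le nrm_ge0 andbT; apply/ler_addgt0Pr => e e0; rewrite add0r.
have y1 : 0 < nrm y + 1 by rewrite ltr_wpDl ?nrm_ge0.
have [|N hN] := ul (e / (nrm y + 1)); first by rewrite divr_gt0.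
rewrite -(uc (maxn N0 N) (leq_maxl _ _)) -innerBl.
apply: le_trans (Cauchy_Schwarz _ _) _.
apply: le_trans (ler_wpM2r (nrm_ge0 _) (ltW (hN _ (leq_maxr _ _)))) _.
by rewrite mulrAC ler_pdivrMr // ler_pM2l // lerDl.
Qed.

Variables (I : set nat) (f : nat -> H).
Hypothesis orth_f : forall m n, I m -> I n -> '[f m, f n] = (m == n)%:R.

Let psum N u := \sum_(0 <= n < N | n \in I) '[u, f n] *: f n.

Lemma inner_psum N u (c : nat -> R[i]) m : I m -> (m < N)%N ->
  '[\sum_(0 <= n < N | n \in I) c n *: f n, f m] = c m.
Proof.
move=> Im mN; rewrite inner_suml (big_nat_single Im mN).
  by rewrite innerZl orth_f // eqxx mulr1.
by move=> n In /negbTE nm; rewrite innerZl orth_f // nm mulr0.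
Qed.

(** Bessel's inequality: the remainder is orthogonal to the partial sum. *)
Lemma psum_le N u : nrm (psum N u) <= nrm u.
Proof.
have h : '[u - psum N u, psum N u] = 0.
  rewrite innerC /psum inner_suml big_nat_cond big1 ?rmorph0 // => n /andP[nN /set_mem In].
  by rewrite innerZl [X in _ * X]innerC innerBl inner_psum // subrr rmorph0 mulr0.
have := pythagoras h; rewrite subrK => e.
rewrite -ler_sqr ?nnegrE ?nrm_ge0 // e lerDr; exact: sqr_ge0.
Qed.

Lemma psumP N a u v : psum N (a *: u + v) = a *: psum N u + psum N v.
Proof.
rewrite /psum scaler_sumr -big_split /=; apply: eq_bigr => n _.
by rewrite innerDl innerZl scalerDl scalerA.
Qed.

(** The vectors equal to the sum of their Fourier series form a subspace, which is
closed because the partial sums are contractions. *)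
Lemma Fourier_cvg u : cspan (f @` I) u -> psum^~ u @ \oo --> u.
Proof.
pose U : set H := [set u | psum^~ u @ \oo --> u].
have psumB N x y : psum N (x - y) = psum N x - psum N y.
  by rewrite addrC -scaleN1r psumP scaleN1r addrC.
have cU : closed_subspace U.
  split.
  - apply/seq_cvgP => e e0; exists 0%N => n _; rewrite /psum big1 ?subrr ?nrm0 //.
    by move=> i _; rewrite inner0l scale0r.
  - move=> a x y /seq_cvgP hx /seq_cvgP hy; apply/seq_cvgP => e e0.
    have e20 : 0 < e / 2 by rewrite divr_gt0.
    have a1 : 0 < nrm a + 1 by rewrite ltr_wpDl ?nrm_ge0.
    have [|N1 hN1] := hx (e / 2 / (nrm a + 1)); first by rewrite divr_gt0.
    have [N2 hN2] := hy _ e20; exists (maxn N1 N2) => n.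
    rewrite geq_max => /andP[/hN1 h1 /hN2 h2].
    have -> : a *: x + y - psum n (a *: x + y)
              = a *: (x - psum n x) + (y - psum n y).
      by rewrite psumP scalerBr opprD addrACA.
    apply: le_lt_trans (ler_nrmD _ _) _; rewrite nrmZ [e]splitr.
    apply: ler_ltD => //.
    apply: le_trans (ler_wpM2l (nrm_ge0 _) (ltW h1)) _.
    by rewrite mulrA ler_pdivrMr // mulrC ler_pM2l // lerDl.
  - apply/closed_nrm => x hx; apply/seq_cvgP => e e0.
    have e30 : 0 < e / 3 by rewrite divr_gt0.
    have [w /seq_cvgP/(_ _ e30)[N hN] xw] := hx _ e30.
    exists N => n /hN h.
    have -> : x - psum n x = (x - w) + ((w - psum n w) - psum n (x - w)).
      by rewrite psumB opprB addrA subrKA addrA subrK.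
    apply: le_lt_trans (ler_nrmD _ _) _.
    have := ler_nrmD (w - psum n w) (- psum n (x - w)); rewrite nrmN.
    have := psum_le n (x - w).
    move: xw h; move: (nrm (x - w)) (nrm (w - _)) (nrm (psum _ _)) (nrm (_ - _)).
    by move=> p q r s *; lra.
apply: (cspan_min cU) => _ [m Im <-].
apply/seq_cvgP => e e0; exists m.+1 => n mn.
suff -> : psum n (f m) = f m by rewrite subrr nrm0.
rewrite /psum (big_nat_single Im mn) ?orth_f ?eqxx ?scale1r // => i Ii /negbTE im.
by rewrite orth_f // eq_sym im scale0r.
Qed.

End Fourier.

Section Schmidt.
Context {R : realType} {H : hilbertType R}.
Variables (D E : set H) (T T' : H -> H).
Hypotheses (cD : closed_subspace D) (cE : closed_subspace E)
  (TT' : forall x y, '[T x, y] = '[x, T' y])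
  (TE : forall x, E (T x)) (TD : forall x, orthc D x -> T x = 0).

Let T'T := adj_sym TT'.

(** T vanishes on the complement of D, hence its adjoint takes values in D. *)
Lemma adj_range x : D (T' x).
Proof. by rewrite -(orthcK cD) => w /TD w0; rewrite T'T w0 inner0r. Qed.

(** The adjoint maps f m to s m g m, so each f m is an eigenvector of T T' for
(s m)^2; a vector orthogonal to all of them is annihilated by T', hence is
itself an eigenvector if it is not zero. *)
Lemma schmidt_total_sub :
  schmidt_decomposable D E T -> eig_total (T \o T').
Proof.
move=> [I [f [g [s [fgs orth_f orth_g Th]]]]].
have Dh h : exists p q, [/\ D p, orthc D q & h = p + q].
  have [h1 h2] := oprojP h cD; exists (oproj D h), (h - oproj D h).
  by rewrite subrKC.
have T0 : T 0 = 0 by apply: TD => y _; rewrite inner0l.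
have Tfg x m : D x -> I m -> '[T x, f m] = (s m)%:C * '[x, g m].
  move=> Dx Im; apply: (inner_lim (Th _ Dx)); exists m.+1 => n mn.
  by rewrite (@inner_psum _ _ I f orth_f n 0 (fun n => (s n)%:C * '[x, g n])).
have T'f m : I m -> T' (f m) = (s m)%:C *: g m.
  move=> Im; apply: inner_injr => h; rewrite -TT'.
  have [p [q [Dp Dq ->]]] := Dh h; have [_ Dg _] := fgs _ Im.
  have [L [TL _]] : exists L : {linear H -> H}, T = L /\ True.
    by have [L ->] := linearizable (adj_linear TT'); exists L.
  rewrite TL (linearD L) -TL (TD Dq) addr0 Tfg // innerZr conj_realC.
  by rewrite innerDl (Dq _ Dg) addr0.
have Tg m : I m -> T (g m) = (s m)%:C *: f m.
  move=> Im; have [_ Dg _] := fgs _ Im.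
  apply: inner_inj => y; apply: (inner_lim (Th _ Dg)); exists m.+1 => n mn.
  rewrite (big_nat_single Im mn) ?orth_g ?eqxx ?mulr1 // => i Ii /negbTE im.
  by rewrite orth_g // eq_sym im mulr0 scale0r.
move=> v hv.
have vf m : I m -> '[v, f m] = 0.
  move=> Im; have [||] := @eigenvector0P _ _ (T \o T') (f m) (s m * s m)%:C.
  - rewrite /= T'f //; have [L TL] := linearizable (adj_linear TT').
    by rewrite TL (linearZZ L) -TL Tg // scalerA realcM.
  - by move=> ->; rewrite inner0r.
  - exact: hv.
have T'v : T' v = 0.
  apply: (@orthc_self _ _ D); first exact: adj_range.
  move=> h Dh'; rewrite T'T; apply: inner0C.
  apply: (inner_lim (Th _ Dh')); exists 0%N => n _.
  rewrite inner_suml big1 // => m /set_mem Im.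
  by rewrite innerZl [X in _ * X]innerC vf // rmorph0 mulr0.
have [|//|/(hv _)/inner_eq0 //] := @eigenvector0P _ _ (T \o T') v 0.
by rewrite /= T'v T0 scale0r.
Qed.

(** Take for f the vectors e of an orthonormal eigenbasis of T T' with T' e != 0,
for s n the norm of T' (f n), and for g n the vector T' (f n) / s n.  The Schmidt
series of T h is then the Fourier series of T h along f; no other basis vector
contributes since the inner product of T h with e is that of h with T' e. *)
Lemma schmidt_total_sup : separable_space H ->
  eig_total (T \o T') -> schmidt_decomposable D E T.
Proof.
move=> sepH tot.
have sym x y : '[(T \o T') x, y] = '[x, (T \o T') y] by rewrite /= TT' T'T.
have [E0 [oE0 bE0] eE0] := (diagonalizable_total sym).2 tot.
pose E1 := [set e | E0 e /\ T' e <> 0].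
have /countable_injP[j jinj] : countable E1.
  apply: sub_countable (orthonormal_countable sepH oE0).
  by apply: subset_card_le => e [].
have {jinj}jinj e e' : E1 e -> E1 e' -> j e = j e' -> e = e'.
  by move=> h h'; apply: jinj; apply: mem_set.
pose I := j @` E1.
pose f n := xget 0 [set e | E1 e /\ j e = n].
have fP n : I n -> E1 (f n) /\ j (f n) = n.
  by move=> [e Ee je]; rewrite /f; case: xgetP => [z _ //|/(_ e) []].
pose s n := nrm (T' (f n)).
pose g n := (s n)^-1%:C *: T' (f n).
have s0 n : I n -> 0 < s n.
  move=> /fP[[_ h] _]; rewrite lt_def nrm_ge0 andbT.
  by apply/eqP => /nrm0_eq0.
have orth_f m n : I m -> I n -> '[f m, f n] = (m == n)%:R.
  move=> /fP[[h1 h1'] j1] /fP[[h2 h2'] j2]; rewrite oE0 //.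
  congr (nat_of_bool _)%:R; apply/eqP/eqP => [e|e].
    by rewrite -j1 -j2 e.
  by apply: jinj => //; rewrite j1 j2.
have eig e : E0 e -> exists a, T (T' e) = a *: e by move=> /eE0[_].
exists I, f, g, s; split => //.
- move=> n In; have [[E0f T'f] _] := fP _ In; split; last exact: s0.
    have [a ha] := eig _ E0f.
    have an0 : a != 0.
      apply/eqP => a0; apply: T'f; apply: inner_eq0.
      by rewrite T'T ha a0 scale0r inner0r.
    have -> : f n = a^-1 *: T (T' (f n)) by rewrite ha scalerA mulVf // scale1r.
    by apply: subspaceZ.
  by apply: subspaceZ => //; apply: adj_range.
- move=> m n Im In; rewrite /g innerZl innerZr conj_realC.
  have [mn|mn] := eqVneq m n; last first.
    have [[E0f _] _] := fP _ Im; have [a ha] := eig _ E0f.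
    by rewrite -TT' ha innerZl orth_f // (negbTE mn) !mulr0.
  rewrite -mn inner_nrm -/(s m) -!realcM.
  have -> : (s m)^-1 * ((s m)^-1 * s m ^+ 2) = 1 by field; rewrite gt_eqF ?s0.
  by [].
move=> h Dh.
have -> : (fun N => \sum_(0 <= n < N | n \in I) ((s n)%:C * '[h, g n]) *: f n)
  = (fun N => \sum_(0 <= n < N | n \in I) '[T h, f n] *: f n).
  apply: funext => N; apply: eq_bigr => n /set_mem In.
  rewrite /g innerZr conj_realC mulrA -realcM mulfV ?gt_eqF ?s0 // mul1r.
  by rewrite TT'.
apply: (Fourier_cvg orth_f).
rewrite -(orthcK (cspan_closed _)) => v; rewrite orthc_cspan => hv.
set u := T h; have cE1 := cspan_closed (f @` I).
have [p_in] := oprojP u cE1; set p := oproj _ u in p_in *.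
rewrite orthc_cspan => u_p.
suff -> : u = p.
  by apply: inner0C; move: p_in; rewrite -(orthcK cE1) orthc_cspan => /(_ v hv)/inner0C.
apply: subr0_eq; apply: inner_eq0.
have : orthc (cspan E0) (u - p).
  rewrite orthc_cspan => e Ee.
  have [T'e|T'e] := pselect (T' e = 0); last first.
    have E1e : E1 e by [].
    have Ij : I (j e) by exists e.
    apply: u_p; exists (j e) => //; have [h1 h2] := fP _ Ij.
    exact: jinj.
  rewrite innerBl /u TT' T'e inner0r sub0r.
  suff : orthc (f @` I) e.
    rewrite -orthc_cspan => /(_ _ p_in); rewrite innerC => h0.
    by rewrite -[X in - X]conjCK h0 rmorph0 oppr0.
  move=> _ [n In <-]; have [[E0f T'f] _] := fP _ In; rewrite oE0 //.
  by case: eqP => // ef; exfalso; apply: T'f; rewrite -ef.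
by rewrite /cspan bE0; apply.
Qed.

Lemma schmidt_total : separable_space H ->
  schmidt_decomposable D E T <-> eig_total (T \o T').
Proof.
by move=> sepH; split; [exact: schmidt_total_sub|exact: schmidt_total_sup].
Qed.

End Schmidt.

(** * Comparing eigenvectors of several operators *)

Section Reduction.
Context {R : realType} {H : hilbertType R}.
Implicit Types (x y z e v : H).

Definition total_in (L : set H) (N : H -> H) : Prop :=
  forall v, L v -> (forall e, L e -> eigenvector N e -> '[v, e] = 0) -> v = 0.

Lemma total_in_sub (L : set H) (N1 N2 : H -> H) :
  (forall e, L e -> eigenvector N1 e -> eigenvector N2 e) ->
  total_in L N1 -> total_in L N2.
Proof. by move=> h t v Lv hv; apply: t => // e Le /(h e Le); exact: hv. Qed.

(** Both components of an eigenvector along L and its complement are zero or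
eigenvectors, and every vector of the complement lies in the kernel of N. *)
Lemma eig_total_reduce (L : set H) (N : {linear H -> H}) :
  closed_subspace L -> (forall x, L x -> L (N x)) ->
  (forall x, orthc L x -> N x = 0) ->
  eig_total N <-> total_in L N.
Proof.
move=> cL NL N0.
split=> [tN v Lv hv|tN v hv].
  apply: tN => e [e0 [a ea]].
  have [Lp pq] := oprojP e cL; set p := oproj L e in Lp pq.
  have ep : e = p + (e - p) by rewrite subrKC.
  rewrite ep innerDr (inner0C (pq _ Lv)) addr0.
  have [|->|] := @eigenvector0P _ _ N p a; first 1 last.
  - by rewrite inner0r.
  - exact: hv.
  apply/subr0_eq/(@orthc_self _ _ L).
    by apply: (subspaceB cL (NL _ Lp)); apply: subspaceZ.
  have -> : N p - a *: p = a *: (e - p).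
    by rewrite scalerBr -ea; congr (_ - _); rewrite [X in _ = N X]ep (linearD N) (N0 _ pq) addr0.
  exact: orthcZ.
have [Lp pq] := oprojP v cL; set p := oproj L v in Lp pq.
have vp : v = p + (v - p) by rewrite subrKC.
have q0 : v - p = 0.
  have [|//|/(hv _)] := @eigenvector0P _ _ N (v - p) 0.
    by rewrite N0 // scale0r.
  by rewrite {1}vp innerDl (inner0C (pq _ Lp)) add0r => /inner_eq0.
apply: tN => [|e _]; last exact: hv.
by rewrite vp q0 addr0.
Qed.

(** If T T' e = a e then T' T (T' e) = a T' e.  So a vector v orthogonal to the
eigenvectors of T' T has T v orthogonal to all e, whence T v = 0 and v is itself
zero or an eigenvector of T' T. *)
Lemma eig_total_swap (T T' : H -> H) :
  (forall x y, '[T x, y] = '[x, T' y]) ->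
  eig_total (T \o T') -> eig_total (T' \o T).
Proof.
move=> TT' tT v hv; have T'T := adj_sym TT'.
have [L TL] := linearizable (adj_linear TT').
have [L' TL'] := linearizable (adj_linear T'T).
have Tv : T v = 0.
  apply: tT => e [e0 [a /= ea]]; rewrite TT'.
  have [|->|] := @eigenvector0P _ _ (T' \o T) (T' e) a.
  - by rewrite /= ea TL' (linearZZ L').
  - by rewrite inner0r.
  - exact: hv.
have [|//|/(hv _)/inner_eq0 //] := @eigenvector0P _ _ (T' \o T) v 0.
by rewrite /= Tv TL' (linear0 L') scale0r.
Qed.

End Reduction.

(** * Square roots and commutation *)

Section Sylvester.
Context {R : realType} {H : hilbertType R}.
Implicit Types (x y z e v : H).

Lemma Bernoulli_le (t : R) n : 0 <= t -> 1 + n%:R * t <= (1 + t) ^+ n.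
Proof.
move=> t0; elim: n => [|n IH]; first by rewrite mul0r addr0 expr0.
rewrite exprS; apply: le_trans (ler_wpM2l _ IH); last by rewrite addr_ge0.
rewrite -natr1; have : 0 <= n%:R :> R by rewrite ler0n.
by move: n%:R => m m0; nra.
Qed.

(** The ratio (k + 1) / k exceeds 1, so its powers are unbounded. *)
Lemma geometric_bound_eq0 (k c d : R) : 0 < k -> 0 <= d ->
  (forall n, (k + 1) ^+ n * d <= c * k ^+ n) -> d = 0.
Proof.
move=> k0 d0 h; apply/eqP; rewrite eq_le d0 andbT leNgt; apply/negP => dp.
have hn n : (1 + n%:R * k^-1) * d <= c.
  have kn : 0 < k ^+ n by rewrite exprn_gt0.
  rewrite -(ler_pM2r kn); apply: le_trans (h n).
  rewrite -mulrA [d * _]mulrC mulrA ler_wpM2r //.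
  have -> : (k + 1) ^+ n = (1 + k^-1) ^+ n * k ^+ n.
    by rewrite -exprMn mulrDl mulVf ?mul1r ?gt_eqF.
  by apply: ler_wpM2r (ltW kn) _ _ _; apply: Bernoulli_le; rewrite invr_ge0 ltW.
have c0 : 0 <= c by apply: le_trans (hn 0%N); rewrite mul0r addr0 mul1r.
have := hn (Num.bound (c / d * k)).
have : c / d * k < (Num.bound (c / d * k))%:R.
  by apply: archi_boundP; rewrite !mulr_ge0 ?invr_ge0 // ltW.
move: (Num.bound _)%:R => m; rewrite -ltr_pdivlMr // -(ltr_pM2r dp) divfK ?gt_eqF //.
move=> h1 h2; have : c < (1 + m * k^-1) * d.
  by apply: lt_le_trans h1 _; rewrite mulrDl mul1r lerDr.
lra.
Qed.

(** Uniqueness in the Sylvester equation D M + M D = 0.  For c > k it gives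
D (c - M)^n = (c + M)^n D.  Since M >= 0 is bounded below, c + M expands norms by
at least sqrt (c^2 + 1), whereas c - M expands them by at most c; letting n grow
forces D x = 0. *)
Lemma Sylvester_eq0 (D : H -> H) (M : {linear H -> H}) (b k : R) :
  linear D -> (forall x, nrm (D x) <= b * nrm x) ->
  positive_op M -> 0 <= k ->
  (forall x, complex.Re '[M x, x] <= k * nrm x ^+ 2) ->
  (forall x, nrm x <= nrm (M x)) ->
  (forall x, D (M x) = - M (D x)) ->
  forall x, D x = 0.
Proof.
move=> /linearizable[L DL] Db pM k0 Mk M1 DM x.
pose c := k + 1; have c0 : 0 < c by rewrite ltr_wpDl.
have pos y : 0 <= complex.Re '[M y, y].
  by rewrite -ler0c RRe_real ?pM // ger0_real.
pose F y := c%:C *: y - M y; pose G y := c%:C *: y + M y.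
have DF n y : D (iter n F y) = iter n G (D y).
  elim: n => //= n <-; rewrite /F /G DL (linearB L) (linearZZ L) -DL DM.
  by rewrite opprK.
have ReZ y z : complex.Re '[c%:C *: y, z] = c * complex.Re '[y, z].
  by rewrite innerZl; case: '[y, z] => p q /=; rewrite mul0r subr0.
have Fle y : nrm (F y) ^+ 2 <= c ^+ 2 * nrm y ^+ 2.
  rewrite sqr_nrmB nrmZ nrm_real (gtr0_norm c0) exprMn ReZ.
  have := positive_sqr_bound k0 pM Mk y; rewrite Re_innerC.
  have := pos y; rewrite Re_innerC.
  by rewrite /c; move: (complex.Re _) (nrm (M y) ^+ 2) => p q; nra.
have Gge y : (c ^+ 2 + 1) * nrm y ^+ 2 <= nrm (G y) ^+ 2.
  rewrite sqr_nrmD nrmZ nrm_real (gtr0_norm c0) exprMn ReZ Re_innerC.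
  have := M1 y; rewrite -ler_sqr ?nnegrE ?nrm_ge0 //.
  by have := mulr_ge0 (ltW c0) (pos y); lra.
apply: nrm0_eq0; apply/eqP; rewrite -sqrf_eq0; apply/eqP.
apply: (@geometric_bound_eq0 (c ^+ 2) (b ^+ 2 * nrm x ^+ 2)).
- by rewrite exprn_gt0.
- exact: sqr_ge0.
move=> n; apply: (@le_trans _ _ (nrm (iter n G (D x)) ^+ 2)).
  elim: n => [|n IH]; first by rewrite expr0 mul1r.
  rewrite exprS -mulrA iterS; apply: le_trans (Gge _).
  by rewrite ler_wpM2l // addr_ge0 // sqr_ge0.
rewrite -DF; apply: (@le_trans _ _ ((b * nrm (iter n F x)) ^+ 2)).
  have h := Db (iter n F x).
  by rewrite ler_sqr ?nnegrE ?nrm_ge0 // (le_trans (nrm_ge0 _) h).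
rewrite exprMn -mulrA; apply: ler_wpM2l; rewrite ?sqr_ge0 // [leRHS]mulrC.
elim: n => [|n IH]; first by rewrite expr0 mul1r.
rewrite [_ ^+ n.+1]exprS -mulrA iterS; apply: le_trans (Fle _) _.
by rewrite ler_wpM2l // sqr_ge0.
Qed.

(** The commutator D of Y and M satisfies D M = - M D as soon as Y commutes with
M^2.  This replaces the approximation of M by polynomials in M^2. *)
Lemma commute_sqr (Y M : {linear H -> H}) :
  continuous Y -> continuous M -> positive_op M ->
  (forall x, nrm x <= nrm (M x)) ->
  (forall x, Y (M (M x)) = M (M (Y x))) -> forall x, Y (M x) = M (Y x).
Proof.
move=> /continuous_bounded[b b0 Yb] /continuous_bounded[k k0 Mk] pM M1 YMM x.
pose D x := Y (M x) - M (Y x).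
apply: subr0_eq; rewrite -/(D x).
apply: (@Sylvester_eq0 D M (b * k + k * b) k) => //.
- by move=> a y z; rewrite /D (linearP M) !(linearP Y) (linearP M) scalerBr opprD addrACA.
- move=> y; apply: le_trans (ler_nrmD _ _) _; rewrite nrmN mulrDl -!mulrA.
  apply: lerD; first by apply: le_trans (Yb _) _; rewrite ler_wpM2l.
  by apply: le_trans (Mk _) _; rewrite ler_wpM2l.
- move=> y; apply: le_trans (Re_le_nrm _) _.
  apply: le_trans (Cauchy_Schwarz _ _) _.
  by rewrite expr2 mulrA ler_wpM2r // nrm_ge0.
- by move=> y; rewrite /D YMM (linearB M) opprB.
Qed.

End Sylvester.

(** * The unitary factor of an involution *)

Section Isometries.
Context {R : realType} {H K : hilbertType R}.

(** Polarization recovers the inner product from the norm. *)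
Lemma isometry_inner (U : {linear H -> K}) :
  (forall x, nrm (U x) = nrm x) -> forall x y, '[U x, U y] = '[x, y].
Proof.
move=> iU x y.
have re u v : complex.Re '[U u, U v] = complex.Re '[u, v].
  have := sqr_nrmD (U u) (U v); rewrite -(linearD U) !iU sqr_nrmD; lra.
have := re x y; have := re x (('i)%C *: y).
rewrite (linearZZ U) !innerZr conjcE.
by case: '[U x, U y] => p q; case: '[x, y] => r s /= h ->; congr Complex; lra.
Qed.

(** The squared norm of T' y is the inner product of T (T' y) with y. *)
Lemma adj_continuous (T : {linear H -> K}) (T' : {linear K -> H}) :
  (forall x y, '[T x, y] = '[x, T' y]) -> continuous T -> continuous T'.
Proof.
move=> TT' /continuous_bounded[b b0 Tb]; apply/continuous_bounded.
exists b => // y.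
have [->|n0] := eqVneq (nrm (T' y)) 0; first by rewrite mulr_ge0 ?nrm_ge0.
have np : 0 < nrm (T' y) by rewrite lt_def n0 nrm_ge0.
rewrite -(ler_pM2r np) -expr2 sqr_nrm -TT'.
apply: le_trans (Re_le_nrm _) _; apply: le_trans (Cauchy_Schwarz _ _) _.
by rewrite mulrAC ler_wpM2r ?nrm_ge0.
Qed.

End Isometries.

(** Identities in a module that follow from its axioms become, after testing
against a vector, ring identities between scalars. *)
Ltac linear_identity := apply: inner_inj => ?; rewrite !innerE; ring.

(** Here U B is the polar decomposition of an involution T, V is the adjoint of U,
and P is an orthogonal projection with the same range as T + 1. *)
Section Polar.
Context {R : realType} {H : hilbertType R}.
Implicit Types (x y z : H).
Variables (T T' B U V P : {linear H -> H}).
Hypotheses (TT' : forall x y, '[T x, y] = '[x, T' y])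
  (cT : continuous T) (TT : forall x, T (T x) = x)
  (cB : continuous B) (pB : positive_op B) (BB : forall x, B (B x) = T' (T x))
  (UB : forall x, T x = U (B x))
  (UV : forall x y, '[U x, y] = '[x, V y])
  (PP' : forall x y, '[P x, y] = '[x, P y]) (PP : forall x, P (P x) = P x)
  (TP : forall x, T (P x) = P x) (PT1 : forall x, P (T x + x) = T x + x).

Let T'T := adj_sym TT'.
Let T'T' x : T' (T' x) = x.
Proof. by apply: inner_injr => z; rewrite -!TT' TT. Qed.

(* The inverse of B^2 = T' T is T T', so B T T' is a two-sided inverse of B. *)
Let BBi x : B (B (T (T' x))) = x. Proof. by rewrite BB TT T'T'. Qed.
Let Binj x : B x = 0 -> x = 0.
Proof. by move=> Bx; rewrite -[x]TT (UB x) Bx (linear0 U) (linear0 T). Qed.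
Let BiB x : B (T (T' (B x))) = x.
Proof. by apply/subr0_eq/Binj; rewrite (linearB B) BBi subrr. Qed.
Let BiBi x : B (T (T' (B (T (T' x))))) = T (T' x).
Proof.
by apply/subr0_eq/Binj/Binj; rewrite !(linearB B) !BBi subrr.
Qed.

Let Bsym := positive_symmetric pB.

(** M is B + B^-1: it is positive, M^2 = T' T + 2 + T T' = (T + T')^2, and
U (T + T') = T M T because U B = T and T^2 = 1. *)
Lemma polar_modulus : exists M : {linear H -> H},
  [/\ continuous M, positive_op M, forall x, nrm x <= nrm (M x),
      forall x, M (M x) = T' (T x) + x + x + T (T' x)
    & forall x, U (T x + T' x) = T (M (T x))].
Proof.
have /linearizable[M ME] : linear (fun x => B x + B (T (T' x))).
  move=> a x y; rewrite (linearP T') (linearP T) !(linearP B) scalerDr.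
  by rewrite addrACA.
have {}ME x : M x = B x + B (T (T' x)) by rewrite -ME.
have MM x : M (M x) = T' (T x) + x + x + T (T' x).
  rewrite !ME (linearD B) (linearD T') (linearD T) (linearD B) BBi BiB BiBi BB.
  by rewrite !addrA.
have cT' := adj_continuous TT' cT.
have pBi x : 0 <= '[B (T (T' x)), x].
  by rewrite -{2}[x]BBi -Bsym; exact: pB.
have pM : positive_op M by move=> x; rewrite ME innerDl addr_ge0.
exists M; split => //.
- move: cT cT' cB => /continuous_bounded[b b0 Tb] /continuous_bounded[b' b'0 T'b].
  move=> /continuous_bounded[k k0 Bk]; apply/continuous_bounded.
  exists (k + k * (b * b')); first by rewrite addr_ge0 ?mulr_ge0.
  move=> x; rewrite ME; apply: le_trans (ler_nrmD _ _) _; rewrite mulrDl lerD //.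
  rewrite -!mulrA; apply: le_trans (Bk _) _; rewrite ler_wpM2l //.
  by apply: le_trans (Tb _) _; rewrite ler_wpM2l.
- move=> x; rewrite -ler_sqr ?nnegrE ?nrm_ge0 // [leRHS]sqr_nrm.
  rewrite (positive_symmetric pM) MM !innerDr -(TT' x (T x)) -(T'T x (T' x)) !raddfD /= -!sqr_nrm.
  by have := sqr_ge0 (nrm x); have := sqr_ge0 (nrm (T x)); have := sqr_ge0 (nrm (T' x)); lra.
- move=> x; have [y ->] : exists y, x = T y by exists (T x); rewrite TT.
  rewrite !TT -BB ME (linearD T) [T (B (T _))]UB BBi [T (B y)]UB (linearD U).
  by rewrite addrC.
Qed.

(** With R0 = P U P and N = T + T' the commutation of M with T and P yields
M V = N, hence M R0' = P N P = 2 P and, taking adjoints, R0 M = 2 P.  Therefore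
R0 = R0' and R0 R0' M^2 = 4 P, where M^2 agrees on the range of P with the
operator W = T T' + T + T' + 1. *)
Lemma polar_compression :
  let S x := P (U (P (P (V (P x))))) in
  let W x := T (T' x) + T x + T' x + x in
  forall x, S (W x) = 4 *: P x /\ W (S x) = 4 *: P x.
Proof.
move=> S W x.
have [M [cM pM M1 MM UN]] := polar_modulus.
have Msym := positive_symmetric pM.
have Minj y : M y = 0 -> y = 0.
  move=> My; apply: nrm0_eq0; apply/eqP; rewrite eq_le nrm_ge0 andbT.
  by have := M1 y; rewrite My nrm0.
have PT' y : P (T' y) = P y.
  by apply: inner_injr => z; rewrite -PP' -TT' TP PP'.
have TM : forall y, T (M y) = M (T y).
  apply: commute_sqr => // y; rewrite !MM !(linearD T) !TT.
  by rewrite [RHS]addrC -!addrA; congr (_ + _); rewrite addrA addrC.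
have T'M y : T' (M y) = M (T' y).
  by apply: inner_inj => z; rewrite T'T Msym -TM -T'T -Msym.
have {}UN y : U (T y + T' y) = M y by rewrite UN TM TT.
have NV y : T (V y) + T' (V y) = M y.
  apply: inner_injr => z.
  by rewrite innerDr -TT' -T'T addrC -innerDl -UV UN Msym.
have MV y : M (V y) = T y + T' y.
  apply/subr0_eq/Minj; rewrite (linearB M) MM (linearD M) -TM -T'M -!NV.
  rewrite !(linearD T) !(linearD T') !TT !T'T'.
  rewrite -[X in X - _]addrA [X in _ - X]addrC; exact: subrr.
have PT u : P (T u) = T u + u - P u by rewrite -PT1 (linearD P) addrK.
(* W is symmetric and equals P M^2; hence it also equals M^2 P. *)
have PMM y : P (M (M y)) = T (T' y) + T y + T' y + y.
  rewrite MM !(linearD P) PT' !PT PT'; linear_identity.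
have MMP y : M (M (P y)) = T (T' y) + T y + T' y + y.
  apply: inner_inj => z; rewrite !Msym PP' PMM !innerDr !innerDl.
  rewrite -(T'T y (T' z)) !TT' (T'T y z); ring.
have cP : continuous P.
  apply/continuous_bounded; exists 1 => // y; rewrite mul1r.
  have Py : '[P y, y - P y] = 0 by rewrite innerBr -[in X in _ - X]PP' PP subrr.
  rewrite -ler_sqr ?nnegrE ?nrm_ge0 // -{2}[y](subrKC (P y)) pythagoras //.
  by rewrite lerDl sqr_ge0.
have PM : forall y, P (M y) = M (P y).
  by apply: commute_sqr => // y; rewrite PMM MMP.
have PNP y : P (T (P y) + T' (P y)) = 2 *: P y.
  by rewrite TP (linearD P) PT' PP scaler_nat mulr2n.
pose R0 y := P (U (P y)); pose R0' y := P (V (P y)).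
have VU u w : '[V u, w] = '[u, U w] by rewrite innerC -UV -innerC.
have R0a u w : '[R0 u, w] = '[u, R0' w] by rewrite PP' UV PP'.
have MR0' y : M (R0' y) = 2 *: P y by rewrite -PM MV PNP.
have R0M y : R0 (M y) = 2 *: P y.
  apply: inner_inj => z; rewrite R0a Msym MR0' innerZr innerZl PP'.
  by rewrite [Num.conj _]conjC_nat.
have PR0' y : P (R0' y) = R0' y by rewrite /R0' PP.
have R0Z a y : R0 (a *: y) = a *: R0 y.
  by rewrite /R0 (linearZZ P) (linearZZ U) (linearZZ P).
have R0P y : R0 (P y) = R0 y by rewrite /R0 PP.
(* Evaluate R0 M R0' in the two possible ways. *)
have R0E y : R0' y = R0 y.
  have := R0M (R0' y); rewrite MR0' R0Z R0P PR0' => /(congr1 (fun u => 2^-1 *: u)).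
  by rewrite !scalerA mulVf ?pnatr_eq0 // !scale1r.
have SE y : S y = R0 (R0' y) by [].
split.
  rewrite SE /W -MMP R0E R0M -PM PP R0Z R0P R0M scalerA.
  by rewrite -natrM.
rewrite SE /W -MMP -R0E PR0' MR0' PR0' (linearZZ M) MR0' scalerA.
by rewrite -natrM.
Qed.

End Polar.

(** * The cosine series of a positive operator *)

Lemma geometric_series_cvg (R : realType) (V : completeNormedModType R[i])
    (u : nat -> V) (C : R) : 0 <= C ->
  (forall k, nrm (u k) <= C * 2^-1 ^+ k) -> exists l : V, series u @ \oo --> l.
Proof.
move=> C0 uC; apply: cauchy_seq_cvg => e e0.
have half k : 0 <= 2^-1 ^+ k :> R by rewrite exprn_ge0.
have tail N m : nrm (series u N - series u (N + m)%N) <=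
    C * (2 * 2^-1 ^+ N - 2 * 2^-1 ^+ (N + m)).
  elim: m => [|m IH]; first by rewrite addn0 !subrr nrm0 mulr0.
  have -> : series u N - series u (N + m.+1)%N
            = (series u N - series u (N + m)%N) - u (N + m)%N.
    by rewrite addnS /series /= big_nat_recr //= opprD addrA.
  apply: le_trans (ler_nrmD _ _) _; rewrite nrmN.
  have := uC (N + m)%N; rewrite addnS exprS; move: (2^-1 ^+ (N + m)) IH => h.
  rewrite mulrA mulfV // mul1r; lra.
have C1 : 0 < 2 * C + 1 by rewrite ltr_wpDl // mulr_ge0.
have [|N hN] := @exists_invS_lt _ (e / (2 * C + 1)); first by rewrite divr_gt0.
exists N => n /subnKC <-; apply: le_lt_trans (tail _ _) _.
have h2 : 2^-1 ^+ N <= N.+1%:R^-1 :> R.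
  rewrite exprVn lef_pV2 ?posrE ?exprn_gt0 //.
  by rewrite -natrX ler_nat ltn_expl.
have h3 := hN N (leqnn N); rewrite ltr_pdivlMr // in h3.
have h1 := half (N + (n - N))%N.
move: (half N) h1 h2 h3; move: (2^-1 ^+ (N + _)) (2^-1 ^+ N) N.+1%:R^-1 => a b c.
nra.
Qed.

Section CosOp.
Context {R : realType} {K : hilbertType R}.
Variable X : {linear K -> K}.
Hypotheses (pX : positive_op X)
  (Xle : forall h, '[X h, h] <= (pi / 2)%:C * '[h, h]).

Let Xsym := positive_symmetric pX.

Lemma nrm_X_le h : nrm (X h) <= 2 * nrm h.
Proof.
have p2 := pihalf_lt2 R; have p0 : 0 <= pi / 2 :> R by rewrite divr_ge0 ?pi_ge0.
have Xr y : complex.Re '[X y, y] <= pi / 2 * nrm y ^+ 2.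
  by have := Xle y; rewrite lecE inner_nrm -realcM => /andP[_].
rewrite -ler_sqr ?nnegrE ?mulr_ge0 ?nrm_ge0 // exprMn.
apply: le_trans (positive_sqr_bound p0 pX Xr h) _.
apply: le_trans (ler_wpM2l p0 (Xr h)) _.
rewrite mulrA -expr2 ler_wpM2r ?sqr_ge0 // ler_sqr ?nnegrE //; exact: ltW.
Qed.

Lemma nrm_iter_X_le k h : nrm (iter k X h) <= 2 ^+ k * nrm h.
Proof.
elim: k => [|k IH]; first by rewrite expr0 mul1r.
rewrite iterS exprS -mulrA; apply: le_trans (nrm_X_le _) _.
by rewrite ler_wpM2l.
Qed.

(** Successive terms have ratio 4 / ((2k + 1)(2k + 2)), which is at most 1/2 for
k >= 1; the constant 4 absorbs the first two terms. *)
Lemma cos_coef_le k : 2 ^+ k.*2 / (k.*2)`!%:R <= 4 * 2^-1 ^+ k :> R.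
Proof.
case: k => [|k]; first by rewrite expr0 fact0 divr1 mulr1 ler1n.
elim: k => [|k IH].
  by rewrite /= !factS fact0; lra.
have e (m : nat) : 2 ^+ m.+2 / (m.+2)`!%:R
    = (2 ^+ m / m`!%:R) * (4 / (m.+2%:R * m.+1%:R)) :> R.
  rewrite !factS !exprS !natrM; field.
  by rewrite !nat1r -natrD !pnatr_eq0 -!lt0n fact_gt0.
rewrite [k.+2.*2]doubleS e [2^-1 ^+ k.+2]exprS.
have : (2 <= k.+1.*2)%N by rewrite doubleS.
move: IH; move: (2^-1 ^+ k.+1) (k.+1.*2) => g m IH m2.
have i4 : 4 <= m.+2%:R :> R by rewrite ler_nat !ltnS.
have j3 : 3 <= m.+1%:R :> R by rewrite ler_nat ltnS.
have af : 0 <= 2 ^+ m / m`!%:R :> R by rewrite divr_ge0 // exprn_ge0.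
have h : 4 / (m.+2%:R * m.+1%:R) <= 1 / 2 :> R.
  move: i4 j3; move: m.+2%:R m.+1%:R => p q p4 q3.
  by rewrite ler_pdivrMr; nra.
apply: le_trans (ler_wpM2l af h) _; lra.
Qed.

Lemma nrm_cos_term_le k h :
  nrm (((-1) ^+ k / (k.*2)`!%:R : R[i]) *: iter k.*2 X h)
    <= (4 * nrm h) * 2^-1 ^+ k.
Proof.
rewrite nrmZ nrmM.
have -> : nrm ((-1) ^+ k : R[i]) = 1.
  by apply: complexI; rewrite -nrmE normrX normrN normr1 expr1n.
rewrite mul1r -(rmorph_nat (real_complex R)) -fmorphV nrm_real.
rewrite ger0_norm ?invr_ge0 //.
apply: le_trans (ler_wpM2l _ (nrm_iter_X_le _ _)) _; first by rewrite invr_ge0.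
rewrite mulrA [_^-1 * _]mulrC [leRHS]mulrAC.
by apply: ler_wpM2r (nrm_ge0 h) _ _ _; exact: cos_coef_le.
Qed.

Lemma cos_op_cvg h :
  series (fun k => ((-1) ^+ k / (k.*2)`!%:R : R[i]) *: iter k.*2 X h)
    @ \oo --> cos_op X h.
Proof.
have [|l hl] := geometric_series_cvg _ (nrm_cos_term_le ^~ h).
  by rewrite mulr_ge0 ?nrm_ge0.
by rewrite /cos_op (cvg_lim (@norm_hausdorff _ _) hl).
Qed.

Lemma iter_linear k (a : R[i]) x y :
  iter k X (a *: x + y) = a *: iter k X x + iter k X y.
Proof. by elim: k => //= k ->; rewrite (linearP X). Qed.

Lemma cos_op_linear : linear (cos_op X).
Proof.
move=> a x y; apply: cvg_lim; first exact: norm_hausdorff.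
have -> : series (fun k => ((-1) ^+ k / (k.*2)`!%:R : R[i]) *: iter k.*2 X (a *: x + y))
  = (a \*: series (fun k => ((-1) ^+ k / (k.*2)`!%:R : R[i]) *: iter k.*2 X x))
    \+ series (fun k => ((-1) ^+ k / (k.*2)`!%:R : R[i]) *: iter k.*2 X y).
  apply: funext => n; rewrite /series /= scaler_sumr -big_split /=.
  apply: eq_bigr => k _; rewrite iter_linear scalerDr !scalerA.
  by rewrite [a * _]mulrC.
apply: cvgD; last exact: cos_op_cvg.
by apply: cvgZl_tmp; exact: cos_op_cvg.
Qed.

Lemma cos_scale_cvg (l : R) (z : K) :
  (fun n => (series (cos_coeff' l) n)%:C *: z) @ \oo --> (cos l)%:C *: z.
Proof.
apply/seq_cvgP => e e0; have z1 : 0 < nrm z + 1 by rewrite ltr_wpDl ?nrm_ge0.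
have /cvgrPdist_lt/(_ (e / (nrm z + 1))) := @cvg_cos_coeff' _ l.
case; first by rewrite divr_gt0.
move=> N _ hN; exists N => n /hN h; rewrite -scalerBl -realcB nrmZ nrm_real.
apply: le_lt_trans (_ : _ <= `|cos l - series (cos_coeff' l) n| * (nrm z + 1)) _.
  by rewrite ler_wpM2l // lerDl.
by rewrite -ltr_pdivlMr.
Qed.

Lemma series_cos_coeffZ (l : R) (z : K) n :
  (series (cos_coeff' l) n)%:C *: z =
  \sum_(0 <= k < n) ((-1) ^+ k / (k.*2)`!%:R : R[i]) *: ((l ^+ k.*2)%:C *: z).
Proof.
rewrite /series /= (rmorph_sum (real_complex R)) /= scaler_suml; apply: eq_bigr => k _.
rewrite scalerA /cos_coeff'; congr (_ *: z).
rewrite mulrAC -exprnP !realcM !realcX /=; congr (_ * _ * _).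
  by rewrite (rmorphN (real_complex R)).
by rewrite fmorphV /= rmorph_nat.
Qed.

Lemma cos_op_eigen (l : R) (z : K) : X z = l%:C *: z ->
  cos_op X z = (cos l)%:C *: z.
Proof.
move=> Xz; apply: cvg_lim; first exact: norm_hausdorff.
suff -> : series (fun k => ((-1) ^+ k / (k.*2)`!%:R : R[i]) *: iter k.*2 X z)
  = (fun n => (series (cos_coeff' l) n)%:C *: z) by exact: cos_scale_cvg.
apply: funext => n; rewrite series_cos_coeffZ; apply: eq_bigr => k _.
congr (_ *: _); elim: k.*2 => [|m IH]; first by rewrite scale1r.
by rewrite iterS IH (linearZZ X) Xz scalerA exprSr realcM.
Qed.

(** Let v = (X^2 - l^2) z.  Since x^(2k) - l^(2k) is (x^2 - l^2) times the sum of
the l^(2(k-1-j)) x^(2j) over j < k, the inner product of (X^(2k) - l^(2k)) z with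
v is q k, the sum of the l^(2(k-1-j)) |X^j v|^2, which is nonnegative.  As X <= 2
and l <= 2, q (k+1) <= 8 q k, so the terms q k / (2k)! decrease from k = 1 on, and
the first decrease is by a factor at most 2/3.  The alternating series
sum (-1)^k q k / (2k)! is the inner product of cos(X) z - cos(l) z = 0 with v, and
it is at most - q 1 / 6.  Hence q 1 = |v|^2 = 0, i.e. X^2 z = l^2 z, and
positivity of X gives X z = l z. *)
Lemma cos_op_eigen_inv (l : R) (z : K) : 0 <= l -> l <= pi / 2 ->
  cos_op X z = (cos l)%:C *: z -> X z = l%:C *: z.
Proof.
move=> l0 lpi Cz; have p2 := pihalf_lt2 R.
pose v := X (X z) - (l ^+ 2)%:C *: z.
pose q := fix q k := if k is k'.+1 then l ^+ 2 * q k' + nrm (iter k' X v) ^+ 2 else 0.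
have iter_sym k x y : '[iter k X x, y] = '[x, iter k X y].
  by elim: k x y => //= k IH x y; rewrite Xsym IH -iterSr.
have qE k : complex.Re '[iter k.*2 X z - (l ^+ k.*2)%:C *: z, v] = q k.
  elim: k => [|k IH].
    by rewrite /= expr0 scale1r subrr inner0l.
  have -> : iter k.+1.*2 X z - (l ^+ k.+1.*2)%:C *: z
     = iter k X (iter k X v) + (l ^+ 2)%:C *: (iter k.*2 X z - (l ^+ k.*2)%:C *: z).
    have -> : iter k.+1.*2 X z = iter k.*2 X ((l ^+ 2)%:C *: z + v).
      by rewrite doubleS !iterSr subrKC.
    rewrite iter_linear -iterD addnn scalerBr scalerA -realcM -exprD add2n -doubleS.
    by rewrite addrAC addrC.
  rewrite innerDl iter_sym inner_nrm innerZl /= -IH.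
  by case: '[_, v] => a b /=; rewrite mul0r subr0 addrC.
have q1 : q 1%N = nrm v ^+ 2 by rewrite /= mulr0 add0r.
have q0 k : 0 <= q k.
  elim: k => [|k IH]; first exact: lexx.
  by apply: addr_ge0; [apply: mulr_ge0 => //; exact: sqr_ge0|exact: sqr_ge0].
have qS k : q k.+2 <= 8 * q k.+1.
  have l4 : l ^+ 2 <= 4.
    have -> : 4 = 2 ^+ 2 :> R by ring.
    by rewrite ler_sqr ?nnegrE //; lra.
  have X4 : nrm (iter k.+1 X v) ^+ 2 <= 4 * nrm (iter k X v) ^+ 2.
    have -> : 4 = 2 ^+ 2 :> R by ring.
    by rewrite -exprMn ler_sqr ?nnegrE ?mulr_ge0 ?nrm_ge0 // iterS nrm_X_le.
  have h1 : nrm (iter k X v) ^+ 2 <= q k.+1 by rewrite /= lerDr mulr_ge0 ?sqr_ge0.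
  have h2 : l ^+ 2 * q k.+1 <= 4 * q k.+1 by rewrite ler_wpM2r.
  by rewrite -[q k.+2]/(l ^+ 2 * q k.+1 + nrm (iter k.+1 X v) ^+ 2); lra.
pose t k := q k / (k.*2)`!%:R.
have t0 k : 0 <= t k by rewrite divr_ge0.
have tS k : t k.+2 <= 2 / 3 * t k.+1.
  rewrite /t [k.+2.*2]doubleS.
  have : (2 <= k.+1.*2)%N by rewrite doubleS.
  move: (qS k) (q0 k.+1); move: (q k.+2) (q k.+1) (k.+1.*2) => a b m ab b0 m2.
  rewrite 2!factS !natrM.
  have i4 : 4 <= m.+2%:R :> R by rewrite ler_nat !ltnS.
  have j3 : 3 <= m.+1%:R :> R by rewrite ler_nat ltnS.
  have f0 : 0 < m`!%:R :> R by rewrite ltr0n fact_gt0.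
  move: i4 j3 f0; move: m.+2%:R m.+1%:R m`!%:R => i j f i4 j3 f0.
  have f0' : f != 0 by rewrite gt_eqF.
  have i0 : 0 < i by lra.
  have j0 : 0 < j by lra.
  rewrite ler_pdivrMr ?mulr_gt0 //.
  have -> : 2 / 3 * (b / f) * (i * (j * f)) = 2 / 3 * b * (i * j).
    by field.
  have ij : 12 <= i * j by nra.
  by nra.
pose S n := \sum_(0 <= k < n) (-1) ^+ k * t k : R.
have SS n : S n.+1 = S n + (-1) ^+ n * t n by rewrite /S big_nat_recr.
have Sbound m : S (m.+1.*2.+1) <= - (1 / 6) * q 1%N.
  elim: m => [|m IH].
    rewrite !SS /S big_geq // /t /= !factS fact0 !expr0 expr1 sqrrN expr1n.
    have := tS 0%N; rewrite /t /= !factS fact0; lra.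
  rewrite doubleS 2!SS -signr_odd -[in X in _ + X]signr_odd /= odd_double /=.
  have := tS (m.+1.*2); have := t0 (m.+1.*2.+1).
  rewrite expr0 expr1; lra.
have SE n : S n = complex.Re '[series (fun k => ((-1) ^+ k / (k.*2)`!%:R : R[i])
     *: iter k.*2 X z) n - (series (cos_coeff' l) n)%:C *: z, v].
  rewrite series_cos_coeffZ -sumrB inner_suml raddf_sum /S; apply: eq_bigr => k _.
  rewrite -scalerBr innerZl /t -qE.
  have -> : (-1) ^+ k / (k.*2)`!%:R = ((-1) ^+ k / (k.*2)`!%:R)%:C :> R[i].
    rewrite realcM realcX (rmorphN (real_complex R)) fmorphV /= rmorph_nat.
    by [].
  case: '[_, v] => a b /=; ring.
have Slim e : 0 < e -> exists N, forall n, (N <= n)%N -> `|S n| < e.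
  move=> e0; have v1 : 0 < nrm v + 1 by rewrite ltr_wpDl ?nrm_ge0.
  have e1 : 0 < e / 2 / (nrm v + 1) by rewrite !divr_gt0.
  have [N1 hN1] := (seq_cvgP _ _).1 (@cos_op_cvg z) _ e1.
  have [N2 hN2] := (seq_cvgP _ _).1 (@cos_scale_cvg l z) _ e1.
  exists (maxn N1 N2) => n; rewrite geq_max => /andP[/hN1 + /hN2].
  rewrite Cz -[nrm (_ - series _ _)]nrmN opprB => h1 h2.
  have h3 : `|S n| <= nrm '[series (fun k => ((-1) ^+ k / (k.*2)`!%:R : R[i])
     *: iter k.*2 X z) n - (series (cos_coeff' l) n)%:C *: z, v].
    rewrite SE; case: '[_, v] => a b; rewrite -lecR -nrmE normc_def lecR /=.
    by rewrite -sqrtr_sqr ler_wsqrtr // lerDl sqr_ge0.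
  apply: le_lt_trans h3 _; apply: le_lt_trans (Cauchy_Schwarz _ _) _.
  apply: (@le_lt_trans _ _ ((e / 2 / (nrm v + 1) + e / 2 / (nrm v + 1)) * nrm v)).
    rewrite ler_wpM2r ?nrm_ge0 //.
    set a := series _ n in h1 *; set b := (series (cos_coeff' l) n)%:C *: z in h2 *.
    have -> : a - b = (a - (cos l)%:C *: z) + ((cos l)%:C *: z - b).
      by rewrite addrA subrK.
    by apply: le_trans (ler_nrmD _ _) _; apply: lerD; exact: ltW.
  have -> : (e / 2 / (nrm v + 1) + e / 2 / (nrm v + 1)) * nrm v
      = e * nrm v / (nrm v + 1) by field; rewrite gt_eqF.
  by rewrite ltr_pdivrMr // ltr_pM2l // ltrDl.
have v0 : v = 0.
  apply: nrm0_eq0; apply/eqP; rewrite -sqrf_eq0 -q1; apply/eqP.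
  apply/eqP; rewrite eq_le q0 andbT leNgt; apply/negP => q1p.
  have [|N hN] := Slim (q 1%N / 6); first by rewrite divr_gt0.
  have := hN (N.+1.*2.+1); rewrite -addnn.
  have NN : (N <= (N.+1 + N.+1).+1)%N by apply: leqW; apply: leq_trans (leqnSn N) (leq_addr _ _).
  move=> /(_ NN); rewrite addnn ltr_norml => /andP[h _].
  have := Sbound N; lra.
(* (X + l) w = 0 with X + l >= 0. *)
pose w := X z - l%:C *: z.
have Xw : X w = - (l%:C *: w).
  apply/eqP; rewrite -addr_eq0 /w (linearB X) (linearZZ X) scalerBr scalerA.
  by rewrite addrA subrK -realcM -expr2; apply/eqP.
have := pX w; rewrite Xw innerNl innerZl inner_nrm -realcM -(rmorphN (real_complex R)) ler0c => h.
have [l1|l1] := eqVneq l 0.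
  rewrite l1 scale0r; apply: inner_eq0; rewrite Xsym.
  by have := v0; rewrite /v l1 expr0n /= scale0r subr0 => ->; rewrite inner0r.
have lp : 0 < l by rewrite lt_def l1.
have : nrm w ^+ 2 = 0.
  by apply/eqP; rewrite eq_le sqr_ge0 andbT -(pmulr_rle0 _ lp); lra.
by move=> /eqP; rewrite sqrf_eq0 => /eqP/nrm0_eq0/subr0_eq.
Qed.

(** With c = sqrt m, the vector w = C z - c z satisfies C w = - c w, so w = 0 by
positivity of C = cos(X); then z is an eigenvector of C for cos (acos c). *)
Lemma cos_sqr_eigen (m : R) (z : K) :
  positive_op (cos_op X) -> nullspace (cos_op X) = [set 0] ->
  0 <= m -> m <= 1 -> cos_op X (cos_op X z) = m%:C *: z ->
  exists l : R, X z = l%:C *: z.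
Proof.
move=> pC nC m0 m1 CCz; have [C CE] := linearizable cos_op_linear.
have inj y : cos_op X y = 0 -> y = 0.
  by move=> Cy; have : nullspace (cos_op X) y by []; rewrite nC.
pose c := Num.sqrt m; have c0 : 0 <= c by rewrite sqrtr_ge0.
have cc : c * c = m by rewrite -expr2 sqr_sqrtr.
have c1 : c <= 1 by rewrite -sqrtr1 ler_wsqrtr.
have Cz : cos_op X z = c%:C *: z.
  have [c00|cn] := eqVneq c 0.
    have -> : z = 0 by apply/inj/inj; rewrite CCz -cc c00 mulr0 scale0r.
    by rewrite scaler0 CE (linear0 C).
  pose w := cos_op X z - c%:C *: z.
  have Cw : cos_op X w = - (c%:C *: w).
    rewrite CE (linearB C) (linearZZ C) -CE CCz -cc realcM -scalerA -/w.
    by rewrite /w scalerBr opprB.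
  have := pC w; rewrite Cw innerNl innerZl inner_nrm -realcM.
  rewrite -(rmorphN (real_complex R)) ler0c oppr_ge0 pmulr_rle0 ?lt_def ?cn //.
  move=> h; apply/subr0_eq/nrm0_eq0/eqP; rewrite -sqrf_eq0 eq_le h.
  exact: sqr_ge0.
have cI : -1 <= c <= 1 by rewrite c1 andbT; lra.
have cosl : cos (acos c) = c by rewrite acosK // in_itv /= cI.
exists (acos c); apply: cos_op_eigen_inv => //.
- exact: acos_ge0.
- rewrite leNgt; apply/negP => lt.
  have : 0 < cos (pi - acos c).
    have := acos_lepi cI; have := pihalf_ge1 R.
    by move=> p1 lp; apply: cos_gt0_pihalf; apply/andP; split; lra.
  by rewrite cosB cospi sinpi mul0r addr0 cosl; lra.
- by rewrite cosl.
Qed.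

Lemma sin_op0 : sin_op X 0 = 0.
Proof.
apply: cvg_lim; first exact: norm_hausdorff.
have -> : series (fun k => ((-1) ^+ k / (k.*2.+1)`!%:R : R[i]) *: iter k.*2.+1 X 0)
   = cst 0.
  apply: funext => n; rewrite /series /= big1 // => k _.
  rewrite (_ : X _ = 0) ?scaler0 // -[k.*2]addn0.
  elim: (k.*2 + 0)%N => [|m IH]; first exact: (linear0 X).
  by rewrite iterS IH (linear0 X).
exact: cvg_cst.
Qed.

End CosOp.

(** * The oblique projection and its adjoint *)

Section ObliqueProjection.
Context {R : realType} {H : hilbertType R}.
Variables (L0 : set H) (Q Q' P : {linear H -> H}).
Hypotheses (cL : closed_subspace L0) (cQ : continuous Q)
  (QQ : forall x, Q (Q x) = Q x) (rQ : range Q = L0)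
  (Qa : forall x y, '[Q x, y] = '[x, Q' y]) (PE : oproj L0 = P).

Let Q'a := adj_sym Qa.

Lemma Q_in x : L0 (Q x). Proof. by rewrite -rQ; exists x. Qed.
Lemma Q_id x : L0 x -> Q x = x.
Proof. by rewrite -rQ => -[y _ <-]; rewrite QQ. Qed.
Lemma P_in x : L0 (P x). Proof. by rewrite -PE; case: (oprojP x cL). Qed.
Lemma P_orth x : orthc L0 (x - P x).
Proof. by rewrite -PE; case: (oprojP x cL). Qed.
Lemma P_id x : L0 x -> P x = x.
Proof.
move=> Lx; rewrite -PE; apply: oproj_uniq => //.
by rewrite subrr => y _; rewrite inner0l.
Qed.
Lemma P_eq0 x : orthc L0 x -> P x = 0.
Proof.
move=> Lx; rewrite -PE; apply: oproj_uniq => //; first by case: cL.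
by rewrite subr0.
Qed.
Lemma P_sym x y : '[P x, y] = '[x, P y].
Proof. by rewrite -PE; exact: oproj_sym. Qed.
Lemma QP x : Q (P x) = P x. Proof. exact/Q_id/P_in. Qed.
Lemma PQ x : P (Q x) = Q x. Proof. exact/P_id/Q_in. Qed.
Lemma PQ' x : P (Q' x) = P x.
Proof. by apply: inner_injr => z; rewrite -P_sym -Qa QP P_sym. Qed.
Lemma adjQ_eq0 x : orthc L0 x -> Q' x = 0.
Proof. by move=> ox; apply: inner_injr => z; rewrite -Qa inner0r inner0C // ox //; exact: Q_in. Qed.

Lemma QQ'_sym x y : '[(Q \o Q') x, y] = '[x, (Q \o Q') y].
Proof. by rewrite /= Qa Q'a. Qed.
Lemma Q'Q_sym x y : '[(Q' \o Q) x, y] = '[x, (Q' \o Q) y].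
Proof. by rewrite /= Q'a Qa. Qed.

Lemma diag_QQ'_total : diagonalizable_op (Q \o Q') <-> total_in L0 (Q \o Q').
Proof.
apply: iff_trans (diagonalizable_total QQ'_sym) _.
apply: (eig_total_reduce (N := (Q \o Q')%FUN : {linear H -> H})) => //.
- by move=> x _; exact: Q_in.
- by move=> x /adjQ_eq0 /= ->; exact: (linear0 Q).
Qed.

Lemma QQ'_diag_swap : diagonalizable_op (Q \o Q') <-> diagonalizable_op (Q' \o Q).
Proof.
split.
  by move/(diagonalizable_total QQ'_sym)/(eig_total_swap Qa)
    => h; apply/(diagonalizable_total Q'Q_sym).
by move/(diagonalizable_total Q'Q_sym)/(eig_total_swap Q'a)
    => h; apply/(diagonalizable_total QQ'_sym).
Qed.

(** Extended by 0 on L0, A is Q (1 - P), with adjoint (1 - P) Q', and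
Q (1 - P) Q' = QQ' - P. *)
Lemma schmidt_A_total (A : H -> H) : separable_space H ->
  (forall x y, L0 x -> orthc L0 y -> Q (x + y) = x + A y) ->
  schmidt_decomposable (orthc L0) L0 A <-> total_in L0 (Q \o Q').
Proof.
move=> sepH QA.
have AQ y : orthc L0 y -> A y = Q y.
  have L00 : L0 0 by case: cL.
  by move=> oy; have := QA _ _ L00 oy; rewrite !add0r => ->.
pose A1 x := Q (x - P x); pose A2 x := Q' x - P (Q' x).
have A12 x y : '[A1 x, y] = '[x, A2 y].
  by rewrite Qa innerBl innerBr P_sym.
have A1E y : orthc L0 y -> A1 y = A y.
  by move=> oy; rewrite AQ // /A1 P_eq0 // subr0.
have GE x : (A1 \o A2) x = Q (Q' x) - P x.
  rewrite /A1 /A2 /= (linearB P) (P_id (P_in _)) subrr subr0 (linearB Q) QP.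
  by rewrite PQ'.
have [G GL] : exists G : {linear H -> H}, A1 \o A2 = G.
  apply: linearizable; apply: (@adj_linear _ _ _ _ (A1 \o A2)) => x y.
  by rewrite /= A12 (adj_sym A12).
have red : eig_total (A1 \o A2) <-> total_in L0 (A1 \o A2).
  rewrite GL; apply: eig_total_reduce => // x hx; rewrite -GL /= /A1; first exact: Q_in.
  by rewrite /A2 (adjQ_eq0 hx) (linear0 P) subrr (linear0 P) subrr (linear0 Q).
have eigG : total_in L0 (A1 \o A2) <-> total_in L0 (Q \o Q').
  split; apply: total_in_sub => e Le [e0 [a ea]]; split => //.
    exists (a + 1); rewrite /= scalerDl -ea GE (P_id Le) scale1r subrK //.
  by exists (a - 1); rewrite GE scalerBl -ea (P_id Le) scale1r.
have sA : schmidt_decomposable (orthc L0) L0 A <-> schmidt_decomposable (orthc L0) L0 A1.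
  split=> -[I [f [g [s [h1 h2 h3 h4]]]]]; exists I, f, g, s; split => // h hh.
    by rewrite A1E //; exact: h4.
  by rewrite -A1E //; exact: h4.
rewrite sA -eigG -red; have cLo := orthc_closed_subspace L0.
have TE x : L0 (A1 x) by exact: Q_in.
have TD x : orthc (orthc L0) x -> A1 x = 0.
  by rewrite (orthcK cL) => Lx; rewrite /A1 (P_id Lx) subrr (linear0 Q).
exact: (schmidt_total cLo cL A12 TE TD sepH).
Qed.

(** The polar decomposition of T = 2Q - 1 satisfies the assumptions of
polar_compression, and T T' + T + T' + 1 = 4 QQ'; so on L0 the operators QQ' and
R0 R0', where R0 is the compression of rho, are inverse to each other and have
the same eigenvectors. *)
Lemma Sd_total (rho B : {linear H -> H}) : separable_space H ->
  polar_decomposition (fun x => 2 *: Q x - x) rho B ->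
  Sd L0 rho <-> total_in L0 (Q \o Q').
Proof.
move=> sepH [[cB pB BB] [cU isoU] nU UB].
have /linearizable[T TE] : linear (fun x => 2 *: Q x - x).
  by move=> a x y; rewrite (linearP Q); linear_identity.
have /linearizable[T' T'E] : linear (fun x => 2 *: Q' x - x).
  by move=> a x y; rewrite (linearP Q'); linear_identity.
rewrite TE in BB nU.
have {}UB x : T x = rho (B x) by rewrite -UB -TE.
have {}TE x : T x = 2 *: Q x - x by rewrite -TE.
have {}T'E x : T' x = 2 *: Q' x - x by rewrite -T'E.
have TT' x y : '[T x, y] = '[x, T' y].
  by rewrite TE T'E !innerE Qa [Num.conj _]conjC_nat.
rewrite (adjoint_uniq TT') in BB.
have {}BB x : B (B x) = T' (T x) by rewrite BB TE.
have TT x : T (T x) = x.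
  by rewrite !TE (linearB Q) (linearZZ Q) QQ; linear_identity.
have cT : continuous T.
  move: cQ => /continuous_bounded[b b0 Qb]; apply/continuous_bounded.
  exists (2 * b + 1); first by rewrite addr_ge0 ?mulr_ge0.
  move=> x; rewrite TE; apply: le_trans (ler_nrmD _ _) _.
  rewrite nrmN nrmZ mulrDl mul1r lerD2r -mulrA.
  have -> : nrm (2 : R[i]) = 2 by apply: complexI; rewrite -nrmE normr_nat rmorph_nat.
  by rewrite ler_wpM2l.
have Tinj x : T x = 0 -> x = 0 by move=> Tx; rewrite -[x]TT Tx (linear0 T).
have Uiso x : nrm (rho x) = nrm x.
  rewrite /nrm isoU // => y; rewrite nU => /Tinj ->; exact: inner0r.
have Uinner := isometry_inner Uiso.
have UV x y : '[rho x, y] = '[x, adjoint rho y] by exact: adjointP.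
have [V VE] := linearizable (adj_linear (adj_sym UV)).
rewrite VE in UV.
have uU : unitary_op rho.
  split => //; apply/seteqP; split => // y _.
  by exists (B (T y)) => //; rewrite -UB TT.
pose R0 x := P (rho (P x)); pose R0' x := P (V (P x)).
have R0a x y : '[R0 x, y] = '[x, R0' y] by rewrite P_sym UV P_sym.
have sdE : Sd L0 rho <-> schmidt_decomposable L0 L0 R0.
  rewrite /Sd /= PE.
  split=> [[_]|] [I [f [g [s [h1 h2 h3 h4]]]]]; last split => //.
    exists I, f, g, s; split => // h hh.
    by rewrite /R0 (P_id hh); exact: h4.
  exists I, f, g, s; split => // h hh.
  by have := h4 _ hh; rewrite /R0 (P_id hh).
have R0L x : L0 (R0 x) by exact: P_in.
have R00 x : orthc L0 x -> R0 x = 0.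
  by move=> ox; rewrite /R0 (P_eq0 ox) (linear0 rho) (linear0 P).
have totE : schmidt_decomposable L0 L0 R0 <-> eig_total (R0 \o R0').
  exact: (schmidt_total cL cL R0a R0L R00 sepH).
have [S SE] : exists S : {linear H -> H}, R0 \o R0' = S.
  apply: linearizable; apply: (@adj_linear _ _ _ _ (R0 \o R0')) => x y.
  by rewrite /= R0a (adj_sym R0a).
have red : eig_total (R0 \o R0') <-> total_in L0 (R0 \o R0').
  rewrite SE; apply: eig_total_reduce => // x hx; rewrite -SE /=; first exact: P_in.
  by rewrite /R0' (P_eq0 hx) (linear0 V) (linear0 P) /R0 !(linear0 P, linear0 rho).
rewrite sdE totE red.
have WE x : T (T' x) + T x + T' x + x = 4 *: Q (Q' x).
  by rewrite !TE T'E (linearB Q) (linearZZ Q); linear_identity.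
have PP x : P (P x) = P x by exact/P_id/P_in.
have TP x : T (P x) = P x by rewrite TE QP scaler_nat mulr2n addrK.
have PT1 x : P (T x + x) = T x + x.
  by rewrite TE subrK (linearZZ P) PQ.
have comp := polar_compression TT' cT TT cB pB BB UB UV P_sym PP TP PT1.
have e4 : (4 : R[i]) != 0 by rewrite pnatr_eq0.
have SQ x : S (Q (Q' x)) = P x.
  have [h _] := comp x; move: h; rewrite WE.
  have -> y : P (rho (P (P (V (P y))))) = S y by rewrite -SE.
  by rewrite (linearZZ S) => /(scalerI e4).
have QS x : Q (Q' (S x)) = P x.
  have [_ h] := comp x; move: h.
  have -> y : P (rho (P (P (V (P y))))) = S y by rewrite -SE.
  by rewrite WE => /(scalerI e4).
rewrite SE; split; apply: total_in_sub => e Le [e0 [a ea]]; split => //.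
  have := QS e; rewrite ea (P_id Le) (linearZZ Q') (linearZZ Q) => qe.
  have a0 : a != 0 by apply: contra e0 => /eqP a0; rewrite -qe a0 scale0r.
  by exists a^-1; rewrite -[in RHS]qe scalerA mulVf // scale1r.
move: ea => /= ea.
have := SQ e; rewrite ea (P_id Le) (linearZZ S) => qe.
have a0 : a != 0 by apply: contra e0 => /eqP a0; rewrite -qe a0 scale0r.
by exists a^-1; rewrite -[in RHS]qe scalerA mulVf // scale1r.
Qed.

(** * The Halmos model *)

Section Halmos.
Variables (K : hilbertType R) (W : {linear (K * K)%type -> H})
  (X : {linear K -> K}).
Hypothesis hW : halmos_model (range Q) (nullspace Q) W X.

Let pX := halmos_X_ge0 hW.
Let Xle := halmos_X_le hW.
Let N := nullspace Q.

Lemma nullspace_closed : closed_subspace N.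
Proof.
split; first exact: (linear0 Q).
  move=> a x y; rewrite /N /nullspace /= => Qx Qy.
  by rewrite (linearP Q) Qx Qy scaler0 addr0.
move: cQ => /continuous_bounded[b b0 Qb].
apply/closed_nrm => x hx; apply: nrm0_eq0; apply/eqP.
rewrite eq_le nrm_ge0 andbT; apply/ler_addgt0Pr => e e0; rewrite add0r.
have b1 : 0 < b + 1 by rewrite ltr_wpDl.
have [|y hy xy] := hx (e / (b + 1)); first by rewrite divr_gt0.
have -> : Q x = Q (x - y) by rewrite (linearB Q) (hy : Q y = 0) subr0.
apply: le_trans (Qb _) _; apply: le_trans (ler_wpM2l b0 (ltW xy)) _.
by rewrite mulrA ler_pdivrMr // mulrC ler_pM2l // lerDl.
Qed.

Let cN := nullspace_closed.

(** For e in L0 with QQ' e = k e, the projection of e onto N(Q) is e - Q' e / k: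
this vector is in N(Q), and Q' e is orthogonal to N(Q). *)
Lemma oproj_null_eigen (k : R[i]) e : L0 e -> k != 0 ->
  Q (Q' e) = k *: e -> P (oproj N e) = (1 - k^-1) *: e.
Proof.
move=> Le k0 ke.
have -> : oproj N e = e - k^-1 *: Q' e.
  apply: oproj_uniq => //.
    by rewrite /N /nullspace /= (linearB Q) (linearZZ Q) ke scalerA mulVf // (Q_id Le) scale1r subrr.
  move=> y Ny; rewrite subKr innerZl Q'a (Ny : Q y = 0) inner0r mulr0 //.
by rewrite (linearB P) (linearZZ P) PQ' (P_id Le) scalerBl scale1r.
Qed.

(** Conversely let u = e - p with p the projection of e onto N(Q).  As u is
orthogonal to N(Q) it satisfies Q' P u = u, where P u = (1 - n) e; applying Q
gives (1 - n) QQ' e = Q u = e. *)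
Lemma eigen_oproj_null (n : R[i]) e : L0 e -> e != 0 ->
  P (oproj N e) = n *: e -> eigenvector (Q \o Q') e.
Proof.
move=> Le e0 ne; split => //.
have [Np up] := oprojP e cN; set p := oproj N e in ne Np up.
have Pu : P (e - p) = (1 - n) *: e.
  by rewrite (linearB P) (P_id Le) ne scalerBl scale1r.
have Q'u : Q' (P (e - p)) = e - p.
  apply: inner_injr => h; rewrite -Qa -P_sym PQ.
  apply: subr0_eq; rewrite -innerBl; apply: inner0C; apply: up.
  by rewrite /N /nullspace /= (linearB Q) QQ subrr.
have : Q (Q' (P (e - p))) = e.
  by rewrite Q'u (linearB Q) (Q_id Le) (Np : Q p = 0) subr0.
rewrite Pu (linearZZ Q') (linearZZ Q) => qe.
have n0 : 1 - n != 0 by apply: contra e0 => /eqP n0; rewrite -qe n0 scale0r.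
by exists (1 - n)^-1; rewrite -[in RHS]qe scalerA mulVf // scale1r.
Qed.

Let innerW u v : '[W u, W v] = '[u.1, v.1] + '[u.2, v.2].
Proof. exact: halmos_isometry hW u v. Qed.

Let PW x y : P (W (x, y)) = W (x, 0).
Proof. by rewrite -(halmos_projS hW x y) rQ PE. Qed.

Let LW x : L0 (W (x, 0)).
Proof. by rewrite -(PW x 0); exact: P_in. Qed.

Let PNW x : P (oproj N (W (x, 0))) = W (cos_op X (cos_op X x), 0).
Proof.
have [C CE] := linearizable (cos_op_linear pX Xle).
by rewrite (halmos_projT hW) sin_op0 // PW CE !(linear0 C) addr0.
Qed.

Let innerW1 x y : '[W (x, 0), W (y, 0)] = '[x, y].
Proof. by rewrite innerW /= inner0l addr0. Qed.

(* The part of L0 outside the generic part: on it QQ' is the identity. *)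
Let M1 := [set c | L0 c /\ orthc N c].

Let cM1 : closed_subspace M1.
Proof.
have [cN0 cNl /closed_nrm cNc] := orthc_closed_subspace N.
have [cL0 cLl /closed_nrm cLc] := cL.
split => //; first by move=> a x y [? ?] [? ?]; split; [apply: cLl|apply: cNl].
apply/closed_nrm => x hx; split; [apply: cLc|apply: cNc] => e /hx[y [h1 h2] h3];
  by exists y.
Qed.

Let M1N c : M1 c -> oproj N c = 0.
Proof.
move=> [_ oc]; apply: oproj_uniq => //; first exact: (linear0 Q).
by rewrite subr0.
Qed.

Let M1W c u : M1 c -> '[W u, c] = 0.
Proof.
move=> [Lc oc].
have : generic_part (range Q) N (W u) by rewrite -(halmos_range hW); exists u.
apply; exists 0, 0, c, 0; split; last by rewrite !add0r addr0.
have [L00 _ _] := cL; have N0 : N 0 by exact: (linear0 Q).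
by split; rewrite rQ; split => // y _; rewrite inner0l.
Qed.

(* L0 is the orthogonal sum of M1 and of the first factor of the model: of the
   four subspaces whose complement is the generic part, L0 meets N(Q) only in 0,
   and so do their orthogonal complements, because Q is a projection. *)
Let L0_split v : L0 v -> exists c z, M1 c /\ v = c + W (z, 0).
Proof.
move=> Lv; have [Mc uc] := oprojP v cM1; set c := oproj M1 v in Mc uc.
have Lu : L0 (v - c) by apply: (subspaceB cL) => //; case: Mc.
have : range W (v - c).
  rewrite (halmos_range hW) rQ => _ [a [b [c' [d [[[La Na] [Lb Nb] Mc' [Ld Nd]] ->]]]]].
  have -> : a = 0 by rewrite -(Q_id La).
  have -> : b = 0.
    apply: inner_eq0; rewrite -[X in '[_, X]](subrKC (Q b) b) innerDr.
    rewrite (Lb _ (Q_in b)) (Nb (b - Q b)) ?addr0 //.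
    by rewrite /nullspace /= (linearB Q) QQ subrr.
  rewrite !add0r innerDr uc // add0r; apply: inner0C; exact: Ld.
move=> [[z y] _ Wzy]; exists c, z; split => //.
by rewrite -(PW z y) Wzy (P_id Lu) subrKC.
Qed.

(** On the first factor, P composed with the projection onto N(Q) acts as
cos(X)^2, so eigenvectors of X give eigenvectors of QQ'.  Conversely an
eigenvector of QQ' in L0 splits along M1 and the first factor, and its second
component is an eigenvector of cos(X)^2, hence zero or an eigenvector of X. *)
Lemma halmos_X_total : diagonalizable_op X <-> total_in L0 (Q \o Q').
Proof.
have Xsym := positive_symmetric pX.
apply: iff_trans (diagonalizable_total Xsym) _.
have W1D a x y : W (a *: x + y, 0) = a *: W (x, 0) + W (y, 0).
  by rewrite -(linearP W); congr (W (_, _)); rewrite /= scaler0 addr0.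
have [C CE] := linearizable (cos_op_linear pX Xle).
split=> [tX v Lv hv|tQ x hx].
  have [w wE] : exists w, forall x, '[W (x, 0), v] = '[x, w].
    apply: (@Riesz _ _ _ (nrm v)) => [a x y|x].
      by rewrite W1D innerDl innerZl.
    apply: le_trans (Cauchy_Schwarz _ _) _; rewrite mulrC.
    have -> // : nrm (W (x, 0)) = nrm x.
    apply/eqP; rewrite -(eqrXn2 (n := 2)) ?nrm_ge0 //.
    by rewrite !sqr_nrm innerW1.
  have w0 : w = 0.
    apply: tX => x [x0 [a Xx]]; apply: inner0C; rewrite -wE; apply: inner0C.
    have aR : a = (complex.Re a)%:C.
      rewrite RRe_real //; have := pX x; rewrite Xx innerZl => h.
      have xx : 0 < '[x, x].
        by rewrite inner_nrm ltcR exprn_gt0 // lt_def nrm_ge0 andbT;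
          apply: contra x0 => /eqP/nrm0_eq0 ->.
      by apply: ger0_real; rewrite -(pmulr_lge0 _ xx).
    rewrite aR in Xx; have Cx := cos_op_eigen Xx.
    apply: (hv _ (LW x)).
    apply: (eigen_oproj_null (n := (cos (complex.Re a))%:C * (cos (complex.Re a))%:C)) => //.
      apply: contra x0 => /eqP Wx; apply/eqP/inner_eq0.
      by rewrite -innerW1 Wx inner0l.
    rewrite PNW Cx CE (linearZZ C) -CE Cx scalerA.
    have := W1D ((cos (complex.Re a))%:C * (cos (complex.Re a))%:C) x 0.
    by rewrite addr0 (linear0 W) addr0.
  have [c [z [Mc vE]]] := L0_split Lv.
  have vW : '[W (z, 0), v] = 0 by rewrite wE w0 inner0r.
  have z0 : W (z, 0) = 0.
    by apply: inner_eq0; move: vW; rewrite {1}vE innerDr M1W // add0r.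
  have vc : v = c by rewrite vE z0 addr0.
  have [//|v0] := eqVneq v 0; apply: inner_eq0; apply: hv => //.
  apply: (eigen_oproj_null (n := 0)) => //.
  by rewrite vc M1N // (linear0 P) scale0r.
suff Wx : W (x, 0) = 0 by apply: inner_eq0; rewrite -innerW1 Wx inner0l.
apply: tQ => // e Le [e0 [k /= ke]].
have en0 : 0 < nrm e by rewrite lt_def nrm_ge0 andbT; apply: contra e0 => /eqP/nrm0_eq0 ->.
(* The eigenvalue k of QQ' at e is real and at least 1, as P Q' e = e. *)
pose kr := nrm (Q' e) ^+ 2 / nrm e ^+ 2.
have kE : k = kr%:C.
  have : '[Q (Q' e), e] = '[Q' e, Q' e] by rewrite Qa.
  rewrite ke innerZl !inner_nrm => h.
  have en : (nrm e ^+ 2)%:C != 0 :> R[i].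
    by apply/eqP => /complexI/eqP; rewrite gt_eqF // exprn_gt0.
  by apply: (mulIf en); rewrite h -realcM divfK // gt_eqF // exprn_gt0.
have kr1 : 1 <= kr.
  rewrite ler_pdivlMr ?exprn_gt0 // mul1r.
  have : '[e, Q' e - e] = 0.
    by apply: inner0C; rewrite -[X in '[_ - X, _]](P_id Le) -PQ'; exact: P_orth.
  by move=> /pythagoras; rewrite subrKC => ->; rewrite lerDl sqr_ge0.
have k0 : k != 0 by rewrite kE; apply/eqP => /complexI k0; move: kr1; rewrite k0; lra.
have PNe := oproj_null_eigen Le k0 ke.
have [c [z [Mc eE]]] := L0_split Le.
pose m := 1 - kr^-1.
have mE : 1 - k^-1 = m%:C by rewrite kE /m realcB fmorphV.
have kv : 0 < kr^-1 by rewrite invr_gt0; lra.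
have m0 : 0 <= m by rewrite subr_ge0 invf_le1 //; lra.
have m1 : m <= 1 by rewrite /m; lra.
have [PN PNE] := oproj_linear cN.
have CCz : cos_op X (cos_op X z) = m%:C *: z.
  apply: subr0_eq; set y := _ - _.
  have Wy : W (y, 0) = m%:C *: c.
    have -> : y = (- m%:C) *: z + cos_op X (cos_op X z) by rewrite scaleNr addrC.
    rewrite W1D -PNW scaleNr; move: PNe.
    rewrite {1}eE PNE (linearD PN) -PNE M1N // add0r mE eE scalerDr => ->.
    by rewrite addrC addrK.
  by apply: inner_eq0; rewrite -innerW1 {2}Wy innerZr M1W // mulr0.
have [l Xz] := cos_sqr_eigen pX Xle (halmos_C_ge0 hW) (halmos_C_null hW) m0 m1 CCz.
rewrite eE innerDr M1W // add0r innerW1.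
have [->|] := eigenvector0P Xz; first exact: inner0r.
exact: hx.
Qed.

End Halmos.

End ObliqueProjection.

Local Close Scope complex_scope.

Theorem theorem6p7 (R : realType) (H : hilbertType R) (L0 : set H)
  (Q rhoQ absQ : {linear H -> H}) (A : H -> H) :
  separable_space H ->
  closed_subspace L0 ->
  continuous Q ->
  (forall x, Q (Q x) = Q x) ->
  range Q = L0 ->
  (forall x y, L0 x -> orthc L0 y -> Q (x + y) = x + A y) ->
  polar_decomposition (fun x => 2 *: Q x - x) rhoQ absQ ->
  [/\ forall (K : hilbertType R) (W : {linear (K * K)%type -> H})
        (X : {linear K -> K}),
        halmos_model (range Q) (nullspace Q) W X ->
        (Sd L0 rhoQ <-> diagonalizable_op X),
      Sd L0 rhoQ <-> diagonalizable_op (Q \o adjoint Q),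
      diagonalizable_op (Q \o adjoint Q) <-> diagonalizable_op (adjoint Q \o Q)
    & Sd L0 rhoQ <-> schmidt_decomposable (orthc L0) L0 A].
Proof.
move=> sepH cL cQ QQ rQ QA polQ.
have Qadj := adjointP cQ.
have [Q' Q'E] := linearizable (adj_linear (adj_sym Qadj)); rewrite Q'E in Qadj *.
have [P PE] := oproj_linear cL.
have SdE := Sd_total cL cQ QQ rQ Qadj PE sepH polQ.
split.
- by move=> K W X hW; rewrite SdE (halmos_X_total cL cQ QQ rQ Qadj PE hW).
- by rewrite SdE (diag_QQ'_total cL rQ Qadj).
- exact: QQ'_diag_swap.
- by rewrite SdE (schmidt_A_total cL QQ rQ Qadj PE sepH QA).
Qed.
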